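(* Let $[B_{\mathcal J}\mid M]$ be a Grothendieck matched pair of algebras. The following are equivalent: (i) The forgetful functor $U\colon[B_{\mathcal J}\mid M]\text{-}\mathcal{S}et\to B_{\mathcal J}\text{-}\mathcal{S}et$ is cartesian closed; (ii) For all $m\in M$, there exist $\{b_i:i\in I\}\in\mathcal J$ and families $(n_i\in M:i\in I)$ and $(c_i\in B:i\in I)$ with $b_i\leqslant m^*c_i$, $mn_i\equiv_{b_i}1$ and $n_im\equiv_{c_i}1$ for all $i\in I$; (iii) The associated Grothendieck Boolean restriction monoid $S_{\mathcal J}$ is étale; (iv) The classifying localic category of $[B_{\mathcal J}\mid M]$ (or, when $\mathcal J$ is the topology of finite partitions, equally its classifying topological category) is a groupoid.
   Context: Boolean algebras have complement $b'$ and are non-degenerate if $0\neq1$. For $P\subseteq B$ write $P^-=P\setminus\{0\}$. A partition of $b\in B$ is a subset $P\subseteq B\setminus\{0\}$ with $\bigvee P=b$ and $c\wedge d=0$ for $c\ne d$ in $P$; ''partition'' alone means partition of $1$. A zero-dimensional topology on $B$ is a collection $\mathcal J$ of partitions containing every finite partition and such that: (1) if $P\in\mathcal J$ and $Q_b\in\mathcal J$ for each $b\in P$, then $\{b\wedge c:b\in P,c\in Q_b\}^-\in\mathcal J$; (2) if $P\in\mathcal J$ and $\alpha\colon P\to I$ is surjective, then each $\bigvee\alpha^{-1}(i)$ exists and $\{\bigvee\alpha^{-1}(i):i\in I\}\in\mathcal J$. A Grothendieck Boolean algebra $B_{\mathcal J}$ is a Boolean algebra with such a topology; a homomorphism $f\colon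 B_{\mathcal J}\to C_{\mathcal K}$ is a Boolean homomorphism with $f(P)^-\in\mathcal K$ for all $P\in\mathcal J$. $\mathcal J_b$ is the set of partitions $P$ of $b$ contained in some $Q\in\mathcal J$. A $B_{\mathcal J}$-set is a set $X$ with an operation $(b,x,y)\mapsto b(x,y)$, $B\times X\times X\to X$, satisfying $b(x,x)=x$, $b(b(x,y),z)=b(x,z)$, $b(x,b(y,z))=b(x,z)$, $1(x,y)=x$, $b'(x,y)=b(y,x)$, $(b\wedge c)(x,y)=b(c(x,y),y)$, together with, for each infinite $P\in\mathcal J$, a function $P\colon X^P\to X$ with $P(\lambda b.x)=x$, $P(\lambda b.\,b(x_b,y_b))=P(\lambda b.\,x_b)$, $b(P(x),x_b)=x_b$ for $b\in P$. Write $x\equiv_by$ iff $b(x,y)=y$. These equivalence relations determine the structure; equivalently a $B_{\mathcal J}$-set is a set with equivalence relations $\equiv_b$ ($b\in B$), $\equiv_0$ being total, such that $x\equiv_by$, $c\leqslant b$ imply $x\equiv_cy$, and for all $P\in\mathcal J$, $x\in X^P$ there is a unique $z$ with $z\equiv_bx_b$ for all $b\in P$. Homomorphisms are functions preserving each $\equiv_b$. A Grothendieck matched pair $[B_{\mathcal J}\mid M]$ is a non-degenerate Grothendieck Boolean algebra $B_{\mathcal J}$, a monoid $M$, a $B_{\mathcal J}$-set structure on $M$, and a left action $(m,b)\mapsto m^*b$ of $M$ on $B_{\mathcal J}$ by Grothendieck Boolean homomorphisms, with: $m\equiv_bn\Rightarrow mp\equiv_bnp$; $n\equiv_bp\Rightarrow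 mn\equiv_{m^*b}mp$; $m\equiv_bn\Rightarrow b\wedge m^*c=b\wedge n^*c$. A $[B_{\mathcal J}\mid M]$-set is a set $X$ with $B_{\mathcal J}$-set and left $M$-set structures such that $m\equiv_bn\Rightarrow m\cdot x\equiv_bn\cdot x$ and $x\equiv_by\Rightarrow m\cdot x\equiv_{m^*b}m\cdot y$; homomorphisms preserve both structures. The categories $B_{\mathcal J}\text{-}\mathcal{S}et$ and $[B_{\mathcal J}\mid M]\text{-}\mathcal{S}et$ are cartesian closed. A finite-product-preserving functor $U\colon\mathcal C\to\mathcal D$ between cartesian closed categories is cartesian closed if for all $Y,Z\in\mathcal C$ the map $U(Z^Y)\to UZ^{UY}$, transpose of $U(Z^Y)\times UY\cong U(Z^Y\times Y)\xrightarrow{U(\mathrm{ev})}UZ$, is invertible. The associated Grothendieck Boolean restriction monoid $S_{\mathcal J}$ of $[B_{\mathcal J}\mid M]$ is $S=\{(b,m):b\in B,\ m\in M/{\equiv_b}\}$, with elements written $m|_b$, unit $1|_1$, product $m|_b\,n|_c=(mn)|_{b\wedge m^*c}$, and restriction $(m|_b)^+=1|_b$; it is ordered by $s\leqslant t$ iff $s^+t=s$, its restriction idempotents $E(S)=\{1|_b\}$ are identified with $B$, and $E(S)$ carries the topology $\mathcal J$. A subset $A\subseteq S$ is admissible if $a^+c^+=0$ for distinct $a,c\in A$ (where $0=1|_0$) and $\{a^+:a\in A\}^-$ is contained in a partition in $\mathcal J$; admissible subsets have joins. An element $s$ is a partial isomorphism if there is $t\in S$ with $st=s^+$ and $ts=t^+$.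 $S_{\mathcal J}$ is étale if each $s\in S$ is the join of an admissible set of partial isomorphisms. A $\mathcal J$-closed ideal of $B$ is an ideal $I$ with $b\in I$ whenever $P\subseteq I$ for some $P\in\mathcal J_b$; $\mathrm{Idl}_{\mathcal J}(B)$ is the frame of these, made a $B_{\mathcal J}$-set via $I\equiv_bJ$ iff $I\cap{\downarrow}b=J\cap{\downarrow}b$. For $m\in M$, $m^*I$ is the $\mathcal J$-closed ideal generated by $\{m^*b:b\in I\}$. The classifying localic category has: locale of objects $C_0$ given by the frame $\mathrm{Idl}_{\mathcal J}(B)$; locale of arrows $C_1$ given by the frame of $B_{\mathcal J}$-set homomorphisms $M\to\mathrm{Idl}_{\mathcal J}(B)$ ordered pointwise; source $s^*(I)=\lambda m.\,I$; target $t^*(I)=\lambda m.\,m^*I$; identities $i^*(f)=f(1)$; and composition $C_1\times_{C_0}C_1\to C_1$ with inverse image $f\mapsto\lambda m,n.\,f(mn)$. Here $C_1\times_{C_0}C_1$ is identified with the locale of all functions $f\colon M\times M\to\mathrm{Idl}_{\mathcal J}(B)$ such that each $f(-,n)$ is a $B_{\mathcal J}$-set homomorphism and each $f(m,-)$ satisfies $n\equiv_bn'\Rightarrow f(m,n)\equiv_{m^*b}f(m,n')$; the projections have inverse images $f\mapsto\lambda m,n.\,f(m)$ and $g\mapsto\lambda m,n.\,m^*(g(n))$ (the first arrow of a composable pair being followed by the second). It is a groupoid if it is an internal groupoid in locales. When $\mathcal J$ is the topology of finite partitions, the classifying topological category has: space of objects the Stone space of ultrafilters $\mathcal U$ on $B$;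 arrows the pairs $(\mathcal U,m\in M/{\equiv_{\mathcal U}})$, where $m\equiv_{\mathcal U}n$ iff $m\equiv_bn$ for some $b\in\mathcal U$, topologised by the basic opens $\{(\mathcal U,m):b\in\mathcal U\}$ for $b\in B$, $m\in M$; source and target of $(\mathcal U,m)$ given by $\mathcal U$ and $m_!\mathcal U=\{b:m^*b\in\mathcal U\}$; identities $(\mathcal U,1)$; composition of $(\mathcal U,m)$ followed by $(m_!\mathcal U,n)$ equal to $(\mathcal U,mn)$. *)

(* Defs.v *)
From HB Require Import structures.
From mathcomp Require Import all_boot all_order.
From mathcomp Require Import generic_quotient.
From mathcomp Require Import mathcomp_extra boolp classical_sets functions cardinality.
From mathcomp Require Import topology.

Set Implicit Arguments.
Unset Strict Implicit.
Unset Printing Implicit Defensive.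

Import Order.Theory.

Local Open Scope classical_set_scope.
Local Open Scope order_scope.
Local Open Scope quotient_scope.

Section BooleanTopology.
Context {d : Order.disp_t} (B : ctbDistrLatticeType d).
Implicit Types (P Q : set B) (b c : B).

Definition minus0 P : set B := [set b | P b /\ b <> \bot].

Definition is_partition b P : Prop :=
  [/\ ~ P \bot, supremums P b &
      forall c e, P c -> P e -> c <> e -> c `&` e = \bot].

Record zdtopology := ZdTopology {
  zdt :> set B -> Prop;
  zdt_partition : forall P, zdt P -> is_partition \top P;
  zdt_finite : forall P, is_partition \top P -> finite_set P -> zdt P;
  zdt_refine : forall P (Q : B -> set B),
    zdt P -> (forall b, P b -> zdt (Q b)) ->
    zdt (minus0 [set a | exists b c, [/\ P b, Q b c & a = b `&` c]]);
  zdt_coarsen : forall P (I : Type) (alpha : P -> I),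
    zdt P -> (forall i, exists p, alpha p = i) ->
    exists s : I -> B,
      (forall i, supremums [set val p | p in alpha @^-1` [set i]] (s i)) /\
      zdt (range s)
}.

Definition partitions_of (J : zdtopology) b : set (set B) :=
  [set P | is_partition b P /\ exists2 Q, J Q & (P `<=` Q)%classic].

Definition finite_topology (J : zdtopology) : Prop :=
  forall P, J P <-> is_partition \top P /\ finite_set P.

End BooleanTopology.

Section BooleanHom.
Context {d d' : Order.disp_t}.
Context (B : ctbDistrLatticeType d) (C : ctbDistrLatticeType d').

Record is_boolean_hom (f : B -> C) : Prop := {
  bhom0 : f \bot = \bot;
  bhom1 : f \top = \top;
  bhomI : forall b c, f (b `&` c) = f b `&` f c;
  bhomU : forall b c, f (b `|` c) = f b `|` f c;
  bhomC : forall b, f (~` b) = ~` (f b)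
}.

Definition is_grothendieck_hom (J : zdtopology B) (K : zdtopology C)
    (f : B -> C) : Prop :=
  is_boolean_hom f /\ forall P, J P -> K (minus0 (f @` P)).

End BooleanHom.

Section BSetStructure.
Context {d : Order.disp_t} {B : ctbDistrLatticeType d} (J : zdtopology B).

(* The elements of X^P are the functions P -> X on the subtype P of B. *)
Record bset_on (X : Type) := BSetOn {
  bop : B -> X -> X -> X;
  bglue : forall P : set B, J P -> infinite_set P -> (P -> X) -> X;
  bop_idem : forall b x, bop b x x = x;
  bop_left : forall b x y z, bop b (bop b x y) z = bop b x z;
  bop_right : forall b x y z, bop b x (bop b y z) = bop b x z;
  bop_top : forall x y, bop \top x y = x;
  bop_compl : forall b x y, bop (~` b) x y = bop b y x;
  bop_meet : forall b c x y, bop (b `&` c) x y = bop b (bop c x y) y;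
  bglue_cst : forall P (JP : J P) (iP : infinite_set P) x,
    bglue JP iP (fun=> x) = x;
  bglue_op : forall P (JP : J P) (iP : infinite_set P) (x y : P -> X),
    bglue JP iP (fun p => bop (val p) (x p) (y p)) = bglue JP iP x;
  bop_glue : forall P (JP : J P) (iP : infinite_set P) (x : P -> X) (p : P),
    bop (val p) (bglue JP iP x) (x p) = x p
}.

Definition beq X (S : bset_on X) b x y : Prop := bop S b x y = y.

End BSetStructure.

Lemma partition_compl {d : Order.disp_t} {B : ctbDistrLatticeType d}
    (J : zdtopology B) (b : B) : J (minus0 [set b; ~` b]).
Proof.
apply: zdt_finite; last first.
  by apply: (@sub_finite_set _ _ [set b; ~` b]) => [c []//|]; apply: finite_set2.
split => [[]//|| c e [[->|->] c0] [[->|->] e0] // ce]; last 2 first.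
- by rewrite meetxC.
- by rewrite meetCx.
split => [c _|c ub]; first exact: lex1.
rewrite -(joinxC b) leUx; apply/andP; split.
  by have [->|/eqP b0] := eqVneq b \bot; [exact: le0x|apply: ub; split => //; left].
have [->|/eqP b0] := eqVneq (~` b) \bot; first exact: le0x.
by apply: ub; split => //; right.
Qed.

Section BSetTheory.
Context {d : Order.disp_t} {B : ctbDistrLatticeType d} {J : zdtopology B}.
Context {X : Type} (S : bset_on J X).
Implicit Types (b c : B) (x y z : X) (P : set B).

Lemma beq_refl b x : beq S b x x.
Proof. exact: bop_idem. Qed.

Lemma beq_sym b x y : beq S b x y -> beq S b y x.
Proof. by rewrite /beq => <-; rewrite bop_left bop_idem. Qed.

Lemma beq_trans b x y z : beq S b x y -> beq S b y z -> beq S b x z.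
Proof. by rewrite /beq => h1 h2; rewrite -{1}h2 bop_right -(bop_left S b x y) h1. Qed.

Lemma beq_bot x y : beq S \bot x y.
Proof. by rewrite /beq -compl1 bop_compl bop_top. Qed.

Lemma beq_le b c x y : c <= b -> beq S b x y -> beq S c x y.
Proof.
by move=> /meet_idPl <- h; rewrite /beq bop_meet h bop_idem.
Qed.

Lemma beq_join b c x y : beq S b x y -> beq S c x y -> beq S (b `|` c) x y.
Proof.
move=> hb /beq_sym hc; rewrite /beq -(complK (b `|` c)) bop_compl complU bop_meet.
by rewrite !bop_compl [bop S c x y]beq_sym.
Qed.

Lemma beq_compl_eq b x y : beq S b x y -> beq S (~` b) x y -> x = y.
Proof. by move=> h1 h2; have := beq_join h1 h2; rewrite joinxC /beq bop_top. Qed.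

Lemma beq_split b c x y :
  beq S (b `&` c) x y -> beq S (b `&` ~` c) x y -> beq S b x y.
Proof. by move=> h1 h2; have := beq_join h1 h2; rewrite -meetUr joinxC meetx1. Qed.

Lemma bop_beql b x y : beq S b (bop S b x y) x.
Proof. by rewrite /beq bop_left bop_idem. Qed.

Lemma bop_beqr b x y : beq S (~` b) (bop S b x y) y.
Proof. by rewrite /beq bop_compl bop_right bop_idem. Qed.

Lemma beq_sep P x y : J P -> (forall b, P b -> beq S b x y) -> x = y.
Proof.
move=> JP h; have [finP|iP] := pselect (finite_set P); last first.
  rewrite -[LHS](bglue_cst S JP iP) -[RHS](bglue_cst S JP iP).
  rewrite -(bglue_op S JP iP (fun=> x) (fun=> y)); congr bglue.
  by apply: funext => p; apply: h; apply: set_mem; exact: valP.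
have [_ [_ lub] _] := zdt_partition JP.
have /finite_seqP[s Ps] := finP; rewrite {}Ps {P JP finP} in h lub.
have : beq S (\join_(b <- s) b) x y.
  elim: s h {lub} => [|b s IH] h; first by rewrite big_nil; exact: beq_bot.
  rewrite big_cons; apply: beq_join; first by apply: h; rewrite /= mem_head.
  by apply: IH => c cs; apply: h; rewrite /= inE (cs : c \in s) orbT.
suff -> : \join_(b <- s) b = \top by rewrite /beq bop_top.
apply/le_anti/andP; split; first exact: lex1.
by apply: lub => b bs; exact: joins_sup_seq.
Qed.

Lemma beq_sep_le P c x y :
  J P -> (forall b, P b -> beq S (c `&` b) x y) -> beq S c x y.
Proof.
move=> JP h; apply: beq_sep JP _ => b Pb.
apply: (@beq_split _ c).
  apply: beq_trans (beq_le (leIr _ _) (bop_beql c x y)) _.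
  by rewrite meetC; exact: h.
exact: beq_le (leIr _ _) (bop_beqr c x y).
Qed.

Lemma beq_glue P (x : B -> X) :
  J P -> exists z, forall b, P b -> beq S b z (x b).
Proof.
move=> JP; have [finP|iP] := pselect (finite_set P); last first.
  exists (bglue S JP iP (fun p => x (val p))) => b Pb.
  exact: (bop_glue S JP iP (fun p => x (val p)) (exist _ b (mem_set Pb))).
have [_ _ dis] := zdt_partition JP.
have /finite_seqP[s Ps] := finP; rewrite {}Ps {P JP finP} in dis *.
elim: s dis => [|b s IH] dis; first by exists (x \bot).
have [|z hz] := IH.
  by move=> c e cs es; apply: dis; rewrite /= inE ?(cs : c \in s) ?(es : e \in s) orbT.
exists (bop S b (x b) z) => c; rewrite /= inE => /orP[/eqP -> //|cs].
  exact: bop_beql.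
have [->|/eqP cb] := eqVneq c b; first exact: bop_beql.
apply: beq_trans (hz _ cs); apply: beq_le (bop_beqr b (x b) z).
rewrite -disj_leC; apply/eqP; apply: dis => //=; first by rewrite inE cs orbT.
exact: mem_head.
Qed.

Lemma bop_cong b c x x' y y' : beq S c x x' -> beq S c y y' ->
  beq S c (bop S b x y) (bop S b x' y').
Proof.
move=> hx hy; apply: (@beq_split _ b).
  apply: beq_trans (beq_le (leIr _ _) (bop_beql b x y)) _.
  apply: beq_trans (beq_le (leIl _ _) hx) _.
  exact: beq_le (leIr _ _) (beq_sym (bop_beql b x' y')).
apply: beq_trans (beq_le (leIr _ _) (bop_beqr b x y)) _.
apply: beq_trans (beq_le (leIl _ _) hy) _.
exact: beq_le (leIr _ _) (beq_sym (bop_beqr b x' y')).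
Qed.

Lemma bglue_cong P (JP : J P) (iP : infinite_set P) (x y : P -> X) c :
  (forall p, beq S c (x p) (y p)) ->
  beq S c (bglue S JP iP x) (bglue S JP iP y).
Proof.
move=> h; apply: (beq_sep_le JP) => b Pb.
have hx := bop_glue S JP iP x (exist _ b (mem_set Pb)).
have hy := bop_glue S JP iP y (exist _ b (mem_set Pb)).
apply: beq_trans (beq_le (leIr _ _) hx) _.
apply: beq_trans (beq_le (leIl _ _) (h _)) _.
exact: beq_le (leIr _ _) (beq_sym hy).
Qed.

End BSetTheory.

(* The presentation of a B_J-set by equivalence relations, used to build
   exponentials. *)
Section RelationalPresentation.
Context {d : Order.disp_t} {B : ctbDistrLatticeType d} (J : zdtopology B).
Context {X : Type}.

Record is_beq (R : B -> X -> X -> Prop) : Prop := {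
  is_beq_refl : forall b x, R b x x;
  is_beq_sym : forall b x y, R b x y -> R b y x;
  is_beq_trans : forall b x y z, R b x y -> R b y z -> R b x z;
  is_beq_bot : forall x y, R \bot x y;
  is_beq_le : forall b c x y, c <= b -> R b x y -> R c x y;
  is_beq_sep : forall P x y, J P -> (forall b, P b -> R b x y) -> x = y;
  is_beq_glue : forall P (x : B -> X), J P ->
    exists z, forall b, P b -> R b z (x b)
}.

Context {R : B -> X -> X -> Prop} (H : is_beq R).

Let sepC b x y : R b x y -> R (~` b) x y -> x = y.
Proof.
by move=> h1 h2; apply: (is_beq_sep H (partition_compl J b)) => c [[->|->]].
Qed.

Let op_ex b x y : exists z, R b z x /\ R (~` b) z y.
Proof.
have [z hz] := is_beq_glue H (fun c => if c == b then x else y) (partition_compl J b).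
exists z; split.
  have [->|/eqP b0] := eqVneq b \bot; first exact: is_beq_bot H _ _.
  by have := hz b; rewrite eqxx; apply; split => //; left.
have [->|/eqP b0] := eqVneq (~` b) \bot; first exact: is_beq_bot H _ _.
have [e|ne] := eqVneq (~` b) b; last first.
  by have := hz (~` b); rewrite (negbTE ne); apply; split => //; right.
by have := meetCx b; rewrite e meetxx => b00; case: b0; rewrite e.
Qed.

Let op b x y := projT1 (cid (op_ex b x y)).

Let opl b x y : R b (op b x y) x.
Proof. by rewrite /op; case: cid => z []. Qed.

Let opr b x y : R (~` b) (op b x y) y.
Proof. by rewrite /op; case: cid => z []. Qed.

Let opE b x y z : R b z x -> R (~` b) z y -> op b x y = z.
Proof.
move=> hx hy; apply: (@sepC b).
  exact: is_beq_trans H _ _ _ _ (opl _ _ _) (is_beq_sym H hx).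
exact: is_beq_trans H _ _ _ _ (opr _ _ _) (is_beq_sym H hy).
Qed.

Let sep4 b c x y : R (b `&` c) x y -> R (b `&` ~` c) x y ->
  R (~` b `&` c) x y -> R (~` b `&` ~` c) x y -> x = y.
Proof.
move=> h1 h2 h3 h4.
have J4 := zdt_refine (partition_compl J b) (fun a _ => partition_compl J c).
apply: (is_beq_sep H J4) => _ [[a [e [[ha _] [he _] ->]]] _].
by case: ha => ->; case: he => ->.
Qed.

Let glue_ex (P : set B) (x : P -> X) : J P -> infinite_set P ->
  exists z, forall p : P, R (val p) z (x p).
Proof.
move=> JP /infinite_setN0 [b0 Pb0].
pose p0 : P := exist _ b0 (mem_set Pb0).
have [z hz] := is_beq_glue H (fun b => x (insubd p0 b)) JP.
exists z => p; have := hz (val p); rewrite valKd; apply.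
by apply: set_mem; exact: valP.
Qed.

Let glue (P : set B) (JP : J P) (iP : infinite_set P) (x : P -> X) := projT1 (cid (glue_ex x JP iP)).

Let glueP (P : set B) (JP : J P) (iP : infinite_set P) (x : P -> X) p :
  R (val p) (glue JP iP x) (x p).
Proof. by rewrite /glue; case: cid. Qed.

Let glueE (P : set B) (JP : J P) (iP : infinite_set P) (x : P -> X) z :
  (forall p : P, R (val p) z (x p)) -> glue JP iP x = z.
Proof.
move=> h; apply: (is_beq_sep H JP) => b Pb.
pose p : P := exist _ b (mem_set Pb).
exact: is_beq_trans H _ _ _ _ (glueP JP iP x p) (is_beq_sym H (h p)).
Qed.

Lemma op_beq b x y : op b x y = y <-> R b x y.
Proof.
split=> [<-|h]; first exact: is_beq_sym H _ _ _ (opl _ _ _).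
by apply: opE; [exact: is_beq_sym H _ _ _ h|exact: is_beq_refl H _ _].
Qed.

Let trans b x y z : R b x y -> R b y z -> R b x z.
Proof. exact: (is_beq_trans H). Qed.

Let op_meet b c x y : op (b `&` c) x y = op b (op c x y) y.
Proof.
have sym := is_beq_sym H; have le := is_beq_le H.
set z := op b _ _.
have zb : R (~` b) (op (b `&` c) x y) z.
  apply: (@trans _ _ y); last exact/sym/opr.
  by apply: (le (~` (b `&` c))) (opr _ _ _); rewrite complI leUl.
have zl : R b z (op c x y) by exact: opl.
apply: (@sep4 b c).
- apply: (@trans _ _ x); first exact: opl.
  apply: sym; apply: (@trans _ _ (op c x y)).
    exact: (le _ _ _ _ (leIl b c) zl).
  exact: (le _ _ _ _ (leIr c b) (opl _ _ _)).
- apply: (@trans _ _ y).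
    apply: (le (~` (b `&` c))) (opr _ _ _); rewrite complI.
    exact: le_trans (leIr _ _) (leUr _ _).
  apply: sym; apply: (@trans _ _ (op c x y)).
    exact: (le _ _ _ _ (leIl b _) zl).
  exact: (le _ _ _ _ (leIr _ b) (opr _ _ _)).
- exact: (le _ _ _ _ (leIl _ _) zb).
- exact: (le _ _ _ _ (leIl _ _) zb).
Qed.

Let op_idem b x : op b x x = x.
Proof. by apply: opE; exact: is_beq_refl H _ _. Qed.

Let op_left b x y z : op b (op b x y) z = op b x z.
Proof.
apply: opE; last exact: opr.
exact: trans (opl _ _ _) (is_beq_sym H (opl _ _ _)).
Qed.

Let op_right b x y z : op b x (op b y z) = op b x z.
Proof.
apply: opE; first exact: opl.
exact: trans (opr _ _ _) (is_beq_sym H (opr _ _ _)).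
Qed.

Let op_top x y : op \top x y = x.
Proof.
apply: opE; first exact: is_beq_refl H _ _.
by rewrite compl1; exact: is_beq_bot H _ _.
Qed.

Let op_compl b x y : op (~` b) x y = op b y x.
Proof. by apply: opE; rewrite ?complK. Qed.

Let glue_cst (P : set B) (JP : J P) (iP : infinite_set P) (x : X) :
  glue JP iP (fun=> x) = x.
Proof. by apply: glueE => p; exact: is_beq_refl H _ _. Qed.

Let glue_op (P : set B) (JP : J P) (iP : infinite_set P) (x y : P -> X) :
  glue JP iP (fun p => op (val p) (x p) (y p)) = glue JP iP x.
Proof.
apply: glueE => p.
exact: trans (glueP JP iP x p) (is_beq_sym H (opl _ _ _)).
Qed.

Let op_glue (P : set B) (JP : J P) (iP : infinite_set P) (x : P -> X) (p : P) :
  op (val p) (glue JP iP x) (x p) = x p.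
Proof. exact: (proj2 (op_beq _ _ _) (glueP JP iP x p)). Qed.

Definition bset_of_beq : bset_on J X :=
  BSetOn op_idem op_left op_right op_top op_compl op_meet
    glue_cst glue_op op_glue.

Lemma beq_of_beq b x y : beq bset_of_beq b x y <-> R b x y.
Proof. exact (op_beq b x y). Qed.

End RelationalPresentation.

Record category := Category {
  obj :> Type;
  hom : obj -> obj -> Type;
  idm : forall X, hom X X;
  cmp : forall X Y Z, hom Y Z -> hom X Y -> hom X Z;
  cmp_idl : forall X Y (f : hom X Y), cmp (idm Y) f = f;
  cmp_idr : forall X Y (f : hom X Y), cmp f (idm X) = f;
  cmpA : forall X Y Z W (h : hom Z W) (g : hom Y Z) (f : hom X Y),
    cmp h (cmp g f) = cmp (cmp h g) f
}.
Arguments idm {c} X.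

Local Notation "g \oc f" := (cmp g f) (at level 40, left associativity).

Definition is_inverse (C : category) (X Y : C) (f : hom X Y) (g : hom Y X) : Prop :=
  g \oc f = idm X /\ f \oc g = idm Y.

Definition is_iso (C : category) (X Y : C) (f : hom X Y) : Prop :=
  exists g, is_inverse f g.

(* expo Z Y is Z^Y. *)
Record cartesian_closed (C : category) := CartesianClosed {
  terminal : C;
  bang : forall X, hom X terminal;
  bang_uniq : forall X (f : hom X terminal), f = bang X;
  prd : C -> C -> C;
  pr1 : forall X Y, hom (prd X Y) X;
  pr2 : forall X Y, hom (prd X Y) Y;
  pairing : forall W X Y, hom W X -> hom W Y -> hom W (prd X Y);
  pairing_pr1 : forall W X Y (f : hom W X) (g : hom W Y), pr1 X Y \oc pairing f g = f;
  pairing_pr2 : forall W X Y (f : hom W X) (g : hom W Y), pr2 X Y \oc pairing f g = g;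
  pairing_uniq : forall W X Y (h : hom W (prd X Y)),
    h = pairing (pr1 X Y \oc h) (pr2 X Y \oc h);
  expo : C -> C -> C;
  ev : forall Z Y, hom (prd (expo Z Y) Y) Z;
  curry : forall W Y Z, hom (prd W Y) Z -> hom W (expo Z Y);
  curryK : forall W Y Z (f : hom (prd W Y) Z),
    ev Z Y \oc pairing (curry f \oc pr1 W Y) (pr2 W Y) = f;
  curry_uniq : forall W Y Z (g : hom W (expo Z Y)),
    g = curry (ev Z Y \oc pairing (g \oc pr1 W Y) (pr2 W Y))
}.
Arguments bang {C} c X.
Arguments pr1 {C} c X Y.
Arguments pr2 {C} c X Y.
Arguments pairing {C} c {W X Y} f g.
Arguments ev {C} c Z Y.
Arguments curry {C} c {W Y Z} f.

Record functor (C D : category) := Functor {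
  fobj :> C -> D;
  fmap : forall X Y, hom X Y -> hom (fobj X) (fobj Y);
  fmap_id : forall X, fmap (idm X) = idm (fobj X);
  fmap_cmp : forall X Y Z (g : hom Y Z) (f : hom X Y),
    fmap (g \oc f) = fmap g \oc fmap f
}.

Section CartesianClosedFunctor.
Context {C D : category} (CC : cartesian_closed C) (DD : cartesian_closed D).
Context (U : functor C D).

Definition product_comparison (X Y : C) :
    hom (U (prd CC X Y)) (prd DD (U X) (U Y)) :=
  pairing DD (fmap U (pr1 CC X Y)) (fmap U (pr2 CC X Y)).

Definition preserves_finite_products : Prop :=
  is_iso (bang DD (U (terminal CC))) /\
  forall X Y, is_iso (product_comparison X Y).

(* k is the isomorphism U(Z^Y) x UY ~ U(Z^Y x Y). *)
Definition is_cartesian_closed_functor : Prop :=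
  preserves_finite_products /\
  forall (Y Z : C)
    (k : hom (prd DD (U (expo CC Z Y)) (U Y)) (U (prd CC (expo CC Z Y) Y))),
    is_inverse (product_comparison (expo CC Z Y) Y) k ->
    is_iso (curry DD (fmap U (ev CC Z Y) \oc k)).

End CartesianClosedFunctor.

(* The data of an internal category: ic_2 is the object of composable pairs,
   i.e. the pullback of ic_tgt along ic_src, with projections ic_fst and ic_snd
   to the first and the second arrow of a pair. *)
Record internal_category_data (C : category) := InternalCategoryData {
  ic_0 : C;
  ic_1 : C;
  ic_2 : C;
  ic_src : hom ic_1 ic_0;
  ic_tgt : hom ic_1 ic_0;
  ic_id : hom ic_0 ic_1;
  ic_fst : hom ic_2 ic_1;
  ic_snd : hom ic_2 ic_1;
  ic_comp : hom ic_2 ic_1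
}.

(* h and k are the maps (id, inv) and (inv, id) into the pullback ic_2. *)
Definition is_internal_groupoid (C : category) (X : internal_category_data C) : Prop :=
  exists inv : hom (ic_1 X) (ic_1 X),
    [/\ ic_src X \oc inv = ic_tgt X,
        ic_tgt X \oc inv = ic_src X,
        exists h : hom (ic_1 X) (ic_2 X),
          [/\ ic_fst X \oc h = idm (ic_1 X), ic_snd X \oc h = inv &
              ic_comp X \oc h = ic_id X \oc ic_src X] &
        exists k : hom (ic_1 X) (ic_2 X),
          [/\ ic_fst X \oc k = inv, ic_snd X \oc k = idm (ic_1 X) &
              ic_comp X \oc k = ic_id X \oc ic_tgt X]].

Section BSetCategory.
Context {d : Order.disp_t} {B : ctbDistrLatticeType d} (J : zdtopology B).

Record bset := BSet { bset_car :> Type; bset_str : bset_on J bset_car }.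

Record bset_hom (X Y : bset) := BSetHom {
  bset_fun :> X -> Y;
  bset_funP : forall b x y,
    beq (bset_str X) b x y -> beq (bset_str Y) b (bset_fun x) (bset_fun y)
}.

Lemma bset_hom_eq X Y (f g : bset_hom X Y) : (forall x, f x = g x) -> f = g.
Proof.
case: f g => [f fP] [g gP] /= /funext e; rewrite e in fP *.
by congr BSetHom; exact: Prop_irrelevance.
Qed.

Definition bset_id X : bset_hom X X := BSetHom (fun _ _ _ h => h).

Definition bset_cmp X Y Z (g : bset_hom Y Z) (f : bset_hom X Y) : bset_hom X Z :=
  BSetHom (fun b x y h => bset_funP g (bset_funP f h)).

Definition BSet_cat : category.
Proof.
by refine (@Category bset bset_hom bset_id bset_cmp _ _ _);
  move=> *; exact: bset_hom_eq.
Defined.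

Definition unit_bset : bset.
Proof.
refine (@BSet unit (@BSetOn _ _ J unit (fun _ _ _ => tt) (fun _ _ _ _ => tt)
  _ _ _ _ _ _ _ _ _)); by move=> *; apply/eqP.
Defined.

Definition prod_bset (X Y : bset) : bset.
Proof.
pose S := bset_str X; pose T := bset_str Y.
refine (@BSet (X * Y) (@BSetOn _ _ J (X * Y)
  (fun b u v => (bop S b u.1 v.1, bop T b u.2 v.2))
  (fun P JP iP u => (bglue S JP iP (fun p => (u p).1),
                     bglue T JP iP (fun p => (u p).2)))
  _ _ _ _ _ _ _ _ _)).
- by move=> b [x y] /=; rewrite !bop_idem.
- by move=> b u v w /=; rewrite !bop_left.
- by move=> b u v w /=; rewrite !bop_right.
- by move=> [x y] v /=; rewrite !bop_top.
- by move=> b u v /=; rewrite !bop_compl.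
- by move=> b c u v /=; rewrite !bop_meet.
- by move=> P JP iP [x y]; rewrite !bglue_cst.
- by move=> P JP iP u v /=; rewrite !bglue_op.
- by move=> P JP iP u p /=; rewrite !bop_glue -surjective_pairing.
Defined.

Lemma beq_prod (X Y : bset) b (u v : prod_bset X Y) :
  beq (bset_str (prod_bset X Y)) b u v <->
  beq (bset_str X) b u.1 v.1 /\ beq (bset_str Y) b u.2 v.2.
Proof.
by case: u v => [x y] [x' y']; rewrite /beq /=; split=> [[-> ->]|[-> ->]].
Qed.

(* Z^Y is the set of homomorphisms Y -> Z with the pointwise structure. *)
Definition exp_bset (Z Y : bset) : bset.
Proof.
pose S := bset_str Z.
refine (@BSet (bset_hom Y Z) (@BSetOn _ _ J (bset_hom Y Z)
  (fun b f g => @BSetHom Y Z (fun y => bop S b (f y) (g y))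
     (fun c x y h => bop_cong b (bset_funP f h) (bset_funP g h)))
  (fun P JP iP f => @BSetHom Y Z (fun y => bglue S JP iP (fun p => f p y))
     (fun c x y h => bglue_cong JP iP (fun p => bset_funP (f p) h)))
  _ _ _ _ _ _ _ _ _)).
- by move=> b f; apply: bset_hom_eq => y /=; rewrite bop_idem.
- by move=> b f g h; apply: bset_hom_eq => y /=; rewrite bop_left.
- by move=> b f g h; apply: bset_hom_eq => y /=; rewrite bop_right.
- by move=> f g; apply: bset_hom_eq => y /=; rewrite bop_top.
- by move=> b f g; apply: bset_hom_eq => y /=; rewrite bop_compl.
- by move=> b c f g; apply: bset_hom_eq => y /=; rewrite bop_meet.
- by move=> P JP iP f; apply: bset_hom_eq => y /=; rewrite bglue_cst.
- by move=> P JP iP f g; apply: bset_hom_eq => y /=; rewrite bglue_op.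
- move=> P JP iP f p; apply: bset_hom_eq => y /=.
  exact: (bop_glue S JP iP (fun p => f p y)).
Defined.

Lemma beq_exp (Z Y : bset) b (f g : exp_bset Z Y) :
  beq (bset_str (exp_bset Z Y)) b f g <->
  forall y, beq (bset_str Z) b (f y) (g y).
Proof.
split=> [h y|h]; first by rewrite /beq -{2}h.
by apply: bset_hom_eq => y; exact: h.
Qed.

Definition BSet_cartesian_closed : cartesian_closed BSet_cat.
Proof.
refine (@CartesianClosed BSet_cat unit_bset
  (fun X => @BSetHom X unit_bset (fun=> tt) (fun _ _ _ _ => erefl)) _
  prod_bset
  (fun X Y => @BSetHom (prod_bset X Y) X fst (fun b u v h => (proj1 (beq_prod b u v) h).1))
  (fun X Y => @BSetHom (prod_bset X Y) Y snd (fun b u v h => (proj1 (beq_prod b u v) h).2))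
  (fun W X Y f g => @BSetHom W (prod_bset X Y) (fun w => (f w, g w))
    (fun b u v h => proj2 (beq_prod b (f u, g u) (f v, g v))
       (conj (bset_funP f h) (bset_funP g h))))
  _ _ _ exp_bset
  (fun Z Y => @BSetHom (prod_bset (exp_bset Z Y) Y) Z (fun u => u.1 u.2) _)
  (fun W Y Z f => @BSetHom W (exp_bset Z Y)
    (fun w => @BSetHom Y Z (fun y => f (w, y)) _) _) _ _).
Unshelve.
all: try by move=> *; exact: bset_hom_eq.
- by move=> X f; apply: bset_hom_eq => x; case: (f x).
- by move=> W X Y h; apply: bset_hom_eq => w /=; rewrite -surjective_pairing.
- by move=> W Y Z f; apply: bset_hom_eq => -[w y].
- by move=> W Y Z g; apply: bset_hom_eq => w; exact: bset_hom_eq.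
- move=> b u v /beq_prod [/beq_exp h1 h2].
  exact: beq_trans (h1 _) (bset_funP _ h2).
- move=> b x y h; apply: (bset_funP (f : bset_hom (prod_bset W Y) Z)); apply/beq_prod; split=> //.
  exact: beq_refl.
- move=> b x y h; apply/beq_exp => z; apply: (bset_funP (f : bset_hom (prod_bset W Y) Z)); apply/beq_prod; split=> //.
  exact: beq_refl.
Defined.

End BSetCategory.

Record matched_pair {d : Order.disp_t} {B : ctbDistrLatticeType d}
    (J : zdtopology B) (M : monoidType) := MatchedPair {
  mp_nondegenerate : \bot != \top :> B;
  mp_bset : bset_on J M;
  mp_act : M -> B -> B;
  mp_act1 : forall b, mp_act 1%g b = b;
  mp_actM : forall m n b, mp_act (m * n)%g b = mp_act m (mp_act n b);
  mp_act_hom : forall m, is_grothendieck_hom J J (mp_act m);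
  mp_mul_congl : forall b m n p,
    beq mp_bset b m n -> beq mp_bset b (m * p)%g (n * p)%g;
  mp_mul_congr : forall b m n p,
    beq mp_bset b n p -> beq mp_bset (mp_act m b) (m * n)%g (m * p)%g;
  mp_act_cong : forall b c m n,
    beq mp_bset b m n -> b `&` mp_act m c = b `&` mp_act n c
}.

Section MatchedPairSets.
Context {d : Order.disp_t} {B : ctbDistrLatticeType d} {J : zdtopology B}.
Context {M : monoidType} (A : matched_pair J M).

Local Notation act := (mp_act A).
Local Notation beqM := (beq (mp_bset A)).

Record bmset := BMSet {
  bm_bset :> bset J;
  bm_act : M -> bm_bset -> bm_bset;
  bm_act1 : forall x, bm_act 1%g x = x;
  bm_actM : forall m n x, bm_act (m * n)%g x = bm_act m (bm_act n x);
  bm_congl : forall b m n x, beqM b m n ->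
    beq (bset_str bm_bset) b (bm_act m x) (bm_act n x);
  bm_congr : forall b m x y, beq (bset_str bm_bset) b x y ->
    beq (bset_str bm_bset) (act m b) (bm_act m x) (bm_act m y)
}.

Record bm_hom (X Y : bmset) := BMHom {
  bm_fun :> bset_hom X Y;
  bm_funE : forall m x, bm_fun (bm_act m x) = bm_act m (bm_fun x)
}.

Lemma bm_hom_eq X Y (f g : bm_hom X Y) : (forall x, f x = g x) -> f = g.
Proof.
case: f g => [f fP] [g gP] /= /bset_hom_eq e; rewrite e in fP *.
by congr BMHom; exact: Prop_irrelevance.
Qed.

Definition bm_id X : bm_hom X X := @BMHom X X (bset_id X) (fun _ _ => erefl).

Definition bm_cmp X Y Z (g : bm_hom Y Z) (f : bm_hom X Y) : bm_hom X Z.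
Proof.
by refine (@BMHom X Z (bset_cmp g f) _) => m x /=; rewrite !bm_funE.
Defined.

Definition BMSet_cat : category.
Proof.
by refine (@Category bmset bm_hom bm_id bm_cmp _ _ _);
  move=> *; exact: bm_hom_eq.
Defined.

Definition forgetful : functor BMSet_cat (BSet_cat J).
Proof.
by refine (@Functor BMSet_cat (BSet_cat J) bm_bset (fun X Y f => bm_fun f) _ _).
Defined.

Definition unit_bmset : bmset.
Proof.
by refine (@BMSet (unit_bset J) (fun _ _ => tt) _ _ _ _) => // *; apply/eqP.
Defined.

Definition prod_bmset (X Y : bmset) : bmset.
Proof.
refine (@BMSet (prod_bset X Y) (fun m u => (bm_act m u.1, bm_act m u.2)) _ _ _ _).
- by move=> [x y] /=; rewrite !bm_act1.
- by move=> m n u /=; rewrite !bm_actM.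
- by move=> b m n u h; apply/beq_prod; split; exact: bm_congl.
- by move=> b m u v /beq_prod [h1 h2]; apply/beq_prod; split; exact: bm_congr.
Defined.

(* M acting on itself by left multiplication. *)
Definition regular_bmset : bmset.
Proof.
refine (@BMSet (BSet (mp_bset A)) (fun m n => (m * n)%g) _ _ _ _).
- exact: mul1g.
- by move=> m n x; rewrite mulgA.
- by move=> b m n x h; exact: mp_mul_congl.
- by move=> b m x y h; exact: mp_mul_congr.
Defined.

(* Z^Y is the set of homomorphisms M x Y -> Z, with M acting by
   (n . f)(m, y) = f(mn, y). *)
Section Exponential.
Context (Z Y : bmset).

Let E := bm_hom (prod_bmset regular_bmset Y) Z.
Let SZ := bset_str Z.

Definition exp_beq (b : B) (f g : E) : Prop :=
  forall (m : M) (y : Y), beq SZ (act m b) (f (m, y)) (g (m, y)).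

Lemma mp_act_minus0 (m : M) (P : set B) : J P ->
  J (minus0 [set act m b | b in P]).
Proof. by move=> JP; have [_] := mp_act_hom A m; exact. Qed.

Lemma mp_act_sep (m : M) (P : set B) c (x y : Z) : J P ->
  (forall b, P b -> beq SZ (c `&` act m b) x y) -> beq SZ c x y.
Proof.
move=> JP h; apply: (beq_sep_le (mp_act_minus0 m JP)) => _ [[b Pb <-] _].
exact: h.
Qed.

Lemma exp_glue (P : set B) (f : B -> E) : J P ->
  exists g : E, forall b, P b -> exp_beq b g (f b).
Proof.
move=> JP; have [_ _ dis] := zdt_partition JP.
have ex (u : M * Y) : exists z, forall b, P b -> beq SZ (act u.1 b) z (f b u).
  have [bm0 _ bmI _ _] := (mp_act_hom A u.1).1.
  pose P' := minus0 [set act u.1 b | b in P].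
  pose pick c := xget \bot [set b | P b /\ act u.1 b = c].
  have [z hz] := beq_glue SZ (fun c => f (pick c) u) (mp_act_minus0 u.1 JP).
  exists z => b Pb; have [e|ne] := pselect (act u.1 b = \bot).
    by rewrite e; exact: beq_bot.
  have /hz : minus0 [set act u.1 b | b in P] (act u.1 b) by split => //; exists b.
  have [Pp ep] : P (pick (act u.1 b)) /\ act u.1 (pick (act u.1 b)) = act u.1 b.
    by apply: (@xgetPex _ \bot [set c | P c /\ act u.1 c = act u.1 b]); exists b.
  suff -> : pick (act u.1 b) = b by [].
  apply: contra_notP ne => /(dis _ _ Pp Pb) e.
  by rewrite -(meetxx (act u.1 b)) -{1}ep -bmI e bm0.
pose g0 u := projT1 (cid (ex u)).
have g0P u b : P b -> beq SZ (act u.1 b) (g0 u) (f b u).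
  by rewrite /g0; case: cid => z; exact.
have gP c (u v : prod_bset regular_bmset Y) :
    beq (bset_str (prod_bset regular_bmset Y)) c u v -> beq SZ c (g0 u) (g0 v).
  move=> h; have [h1 _] := proj1 (beq_prod c u v) h.
  apply: (mp_act_sep (m := u.1) JP) => b Pb.
  apply: beq_trans (beq_le (leIr _ _) (g0P u b Pb)) _.
  apply: beq_trans (beq_le (leIl _ _) (bset_funP (f b) h)) _.
  rewrite (mp_act_cong b h1); apply: beq_le (leIr _ _) _.
  exact/beq_sym/g0P.
have gE n (u : prod_bmset regular_bmset Y) : g0 (bm_act n u) = bm_act n (g0 u).
  apply: (beq_sep (mp_act_minus0 (n * u.1)%g JP)) => _ [[b Pb <-] _].
  apply: beq_trans (g0P (bm_act n u) b Pb) _.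
  by rewrite bm_funE mp_actM; apply/beq_sym/bm_congr/g0P.
exists (@BMHom (prod_bmset regular_bmset Y) Z (BSetHom gP) gE) => b Pb m y.
exact: (g0P (m, y)).
Qed.

Lemma exp_is_beq : is_beq J exp_beq.
Proof.
split.
- by move=> b f m y; exact: beq_refl.
- by move=> b f g h m y; exact/beq_sym/h.
- by move=> b f g k h1 h2 m y; exact: beq_trans (h1 m y) (h2 m y).
- move=> f g m y; have [bm0 _ _ _ _] := (mp_act_hom A m).1.
  by rewrite bm0; exact: beq_bot.
- move=> b c f g /meet_idPl e h m y; have [_ _ bmI _ _] := (mp_act_hom A m).1.
  by rewrite -e bmI; exact: beq_le (leIr _ _) (h m y).
- move=> P f g JP h; apply: bm_hom_eq => -[m y].
  by apply: (beq_sep (mp_act_minus0 m JP)) => _ [[b Pb <-] _]; exact: h.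
- exact: exp_glue.
Qed.

Lemma exp_act_beq (n : M) (f : E) b (u v : prod_bset regular_bmset Y) :
  beq (bset_str (prod_bset regular_bmset Y)) b u v ->
  beq SZ b (f ((u.1 : M) * n, u.2)%g) (f ((v.1 : M) * n, v.2)%g).
Proof.
move=> /beq_prod [h1 h2]; apply: bset_funP.
by apply/beq_prod; split=> //; exact: mp_mul_congl.
Qed.

Definition exp_act (n : M) (f : E) : E.
Proof.
refine (@BMHom (prod_bmset regular_bmset Y) Z (BSetHom (exp_act_beq n f)) _).
move=> m u; rewrite /= -mulgA.
exact: (bm_funE f m ((u.1 : M) * n, u.2)%g).
Defined.

Definition exp_bmset : bmset.
Proof.
refine (@BMSet (BSet (bset_of_beq exp_is_beq)) exp_act _ _ _ _).
- by move=> f; apply: bm_hom_eq => -[m y] /=; rewrite mulg1.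
- by move=> m n f; apply: bm_hom_eq => -[k y] /=; rewrite mulgA.
- move=> b m n f h; apply/beq_of_beq => k y /=.
  apply: bset_funP; apply/beq_prod; split; last exact: beq_refl.
  exact: mp_mul_congr.
- move=> b m f g /beq_of_beq h; apply/beq_of_beq => k y /=.
  by rewrite -mp_actM; exact: h.
Defined.

End Exponential.

Lemma beq_exp_bmset (Z Y : bmset) b (f g : exp_bmset Z Y) :
  beq (bset_str (exp_bmset Z Y)) b f g <-> exp_beq b f g.
Proof. exact: beq_of_beq. Qed.

Section CartesianClosedStructure.

Let CC := BSet_cartesian_closed J.
Let R := regular_bmset.

Definition bm_bang (X : bmset) : bm_hom X unit_bmset :=
  @BMHom X unit_bmset (bang CC X) (fun _ _ => erefl).

Definition bm_pr1 (X Y : bmset) : bm_hom (prod_bmset X Y) X :=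
  @BMHom (prod_bmset X Y) X (pr1 CC X Y) (fun _ _ => erefl).

Definition bm_pr2 (X Y : bmset) : bm_hom (prod_bmset X Y) Y :=
  @BMHom (prod_bmset X Y) Y (pr2 CC X Y) (fun _ _ => erefl).

Definition bm_pair (W X Y : bmset) (f : bm_hom W X) (g : bm_hom W Y) :
  bm_hom W (prod_bmset X Y).
Proof.
refine (@BMHom W (prod_bmset X Y) (pairing CC (bm_fun f) (bm_fun g)) _).
by move=> m w /=; rewrite !bm_funE.
Defined.

Lemma bm_ev_beq (Z Y : bmset) b (u v : prod_bset (exp_bmset Z Y) Y) :
  beq (bset_str (prod_bset (exp_bmset Z Y) Y)) b u v ->
  beq (bset_str Z) b ((u.1 : bm_hom (prod_bmset R Y) Z) ((1%g : M), u.2))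
                     ((v.1 : bm_hom (prod_bmset R Y) Z) ((1%g : M), v.2)).
Proof.
case: u v => [f x] [g y] /beq_prod [/beq_exp_bmset h1 h2] /=.
apply: (@beq_trans _ _ _ _ _ _ _ (f ((1%g : M), y))).
  by apply: bset_funP; apply/beq_prod; split => //; exact: beq_refl.
by have := h1 1%g y; rewrite mp_act1.
Qed.

Definition bm_ev (Z Y : bmset) : bm_hom (prod_bmset (exp_bmset Z Y) Y) Z.
Proof.
refine (@BMHom (prod_bmset (exp_bmset Z Y) Y) Z (BSetHom (@bm_ev_beq Z Y)) _).
move=> m [f y] /=; rewrite mul1g.
by rewrite -(bm_funE f m ((1%g : M), y)) /= mulg1.
Defined.

Lemma bm_curry_beq (W Y Z : bmset) (f : bm_hom (prod_bmset W Y) Z) (w : W) b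
    (u v : prod_bset R Y) :
  beq (bset_str (prod_bset R Y)) b u v ->
  beq (bset_str Z) b (f (bm_act (u.1 : M) w, u.2)) (f (bm_act (v.1 : M) w, v.2)).
Proof.
move=> /beq_prod [h1 h2]; apply: bset_funP; apply/beq_prod; split=> //.
exact: bm_congl.
Qed.

Definition bm_curry_fun (W Y Z : bmset) (f : bm_hom (prod_bmset W Y) Z) (w : W) :
  exp_bmset Z Y.
Proof.
refine (@BMHom (prod_bmset R Y) Z (BSetHom (bm_curry_beq f w)) _).
move=> m u; rewrite /= bm_actM.
exact: (bm_funE f m (bm_act (u.1 : M) w, u.2)).
Defined.

Lemma bm_curry_fun_beq (W Y Z : bmset) (f : bm_hom (prod_bmset W Y) Z) b w w' :
  beq (bset_str W) b w w' ->
  beq (bset_str (exp_bmset Z Y)) b (bm_curry_fun f w) (bm_curry_fun f w').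
Proof.
move=> h; apply/beq_exp_bmset => m y; apply: (bset_funP f); apply/beq_prod.
by split; [exact: bm_congr|exact: beq_refl].
Qed.

Definition bm_curry (W Y Z : bmset) (f : bm_hom (prod_bmset W Y) Z) :
  bm_hom W (exp_bmset Z Y).
Proof.
refine (@BMHom W (exp_bmset Z Y) (BSetHom (@bm_curry_fun_beq W Y Z f)) _).
by move=> m w; apply: bm_hom_eq => -[n y] /=; rewrite bm_actM.
Defined.

Definition BMSet_cartesian_closed : cartesian_closed BMSet_cat.
Proof.
refine (@CartesianClosed BMSet_cat unit_bmset bm_bang _ prod_bmset
  bm_pr1 bm_pr2 bm_pair _ _ _ exp_bmset bm_ev bm_curry _ _).
- by move=> X f; apply: bm_hom_eq => x; case: (f x).
- by move=> W X Y f g; exact: bm_hom_eq.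
- by move=> W X Y f g; exact: bm_hom_eq.
- by move=> W X Y h; apply: bm_hom_eq => w /=; rewrite -surjective_pairing.
- move=> W Y Z f; apply: bm_hom_eq => -[w y].
  exact: (congr1 (fun w' => (f : bm_hom (prod_bmset W Y) Z) (w', y)) (bm_act1 w)).
- move=> W Y Z g; apply: bm_hom_eq => w; apply: bm_hom_eq => -[m y].
  by rewrite /= bm_funE /= mul1g.
Defined.

End CartesianClosedStructure.

End MatchedPairSets.

Section RestrictionMonoid.
Context {d : Order.disp_t} {B : ctbDistrLatticeType d} {J : zdtopology B}.
Context {M : monoidType} (A : matched_pair J M).

Local Notation act := (mp_act A).
Local Notation beqM := (beq (mp_bset A)).

(* (b, m) and (c, n) represent the same element of S iff b = c and m ==_b n. *)
Definition rm_rel : rel (B * M) :=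
  fun s t => (s.1 == t.1) && (bop (mp_bset A) s.1 s.2 t.2 == t.2).

Lemma rm_relP b m c n : reflect (b = c /\ beqM b m n) (rm_rel (b, m) (c, n)).
Proof. by apply: (iffP andP) => /= -[/eqP h1 /eqP h2]. Qed.

Lemma rm_rel_refl : reflexive rm_rel.
Proof. by move=> [b m]; apply/rm_relP; split=> //; exact: beq_refl. Qed.

Lemma rm_rel_sym : symmetric rm_rel.
Proof.
suff h s t : rm_rel s t -> rm_rel t s by move=> s t; apply/idP/idP; exact: h.
case: s t => [b m] [c n] /rm_relP [<- h]; apply/rm_relP; split=> //.
exact: beq_sym.
Qed.

Lemma rm_rel_trans : transitive rm_rel.
Proof.
move=> [c n] [b m] [e p] /rm_relP [<- h1] /rm_relP [<- h2].
by apply/rm_relP; split=> //; exact: beq_trans h1 h2.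
Qed.

Canonical rm_equiv := EquivRel rm_rel rm_rel_refl rm_rel_sym rm_rel_trans.

Definition rmonoid := {eq_quot rm_equiv}.

Implicit Types s t : rmonoid.

(* The element m|_b. *)
Definition res (m : M) (b : B) : rmonoid := \pi_rmonoid (b, m).

Definition rm_one : rmonoid := res 1%g \top.

Definition rm_zero : rmonoid := res 1%g \bot.

Definition rm_mul s t : rmonoid :=
  res ((repr s).2 * (repr t).2)%g
      ((repr s).1 `&` act (repr s).2 (repr t).1).

Definition rm_plus s : rmonoid := res 1%g (repr s).1.

Lemma res_eq m b n c : res m b = res n c <-> b = c /\ beqM b m n.
Proof. by split=> [/eqmodP/rm_relP|h]; last exact/eqmodP/rm_relP. Qed.

Lemma repr_res m b : (repr (res m b)).1 = b /\ beqM b (repr (res m b)).2 m.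
Proof.
have : res (repr (res m b)).2 (repr (res m b)).1 = res m b.
  by rewrite {1}/res -surjective_pairing reprK.
by move=> /res_eq [h1 h2]; split => //; rewrite -{1}h1.
Qed.

Lemma rm_mulE m b n c :
  rm_mul (res m b) (res n c) = res (m * n)%g (b `&` act m c).
Proof.
have [e1 h1] := repr_res m b; have [e2 h2] := repr_res n c.
rewrite /rm_mul e1 e2 (mp_act_cong c h1); apply/res_eq; split=> //.
apply: beq_trans (beq_le (leIl _ _) (mp_mul_congl _ h1)) _.
exact: beq_le (leIr _ _) (mp_mul_congr _ h2).
Qed.

Lemma rm_plusE m b : rm_plus (res m b) = res 1%g b.
Proof. by rewrite /rm_plus (repr_res m b).1. Qed.

Definition rm_le s t : Prop := rm_mul (rm_plus s) t = s.

Definition rm_is_join (T : set rmonoid) s : Prop :=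
  (forall t, T t -> rm_le t s) /\
  forall u, (forall t, T t -> rm_le t u) -> rm_le s u.

(* An idempotent 1|_b is identified with b. *)
Definition rm_admissible (T : set rmonoid) : Prop :=
  (forall s t, T s -> T t -> s <> t -> rm_mul (rm_plus s) (rm_plus t) = rm_zero) /\
  exists2 Q, J Q &
    (minus0 [set b | exists2 s, T s & rm_plus s = res 1%g b] `<=` Q)%classic.

Definition rm_partial_iso s : Prop :=
  exists t, rm_mul s t = rm_plus s /\ rm_mul t s = rm_plus t.

Definition is_etale : Prop :=
  forall s, exists T, [/\ rm_admissible T,
    (forall t, T t -> rm_partial_iso t) & rm_is_join T s].

End RestrictionMonoid.

Record frame := Frame {
  frame_car :> Type;
  fle : frame_car -> frame_car -> Prop;
  ftop : frame_car;
  fmeet : frame_car -> frame_car -> frame_car;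
  fsup : set frame_car -> frame_car;
  fle_refl : forall x, fle x x;
  fle_anti : forall x y, fle x y -> fle y x -> x = y;
  fle_trans : forall x y z, fle x y -> fle y z -> fle x z;
  fle_top : forall x, fle x ftop;
  fle_meet : forall x y z, fle z (fmeet x y) <-> fle z x /\ fle z y;
  fsup_le : forall (U : set frame_car) z,
    fle (fsup U) z <-> forall x, U x -> fle x z;
  fmeet_sup : forall x (U : set frame_car),
    fle (fmeet x (fsup U)) (fsup [set fmeet x y | y in U])
}.

Lemma fle_sup (L : frame) (U : set L) x : U x -> fle x (fsup U).
Proof. by have /fsup_le := fle_refl (fsup U); apply. Qed.

(* A map of locales X -> Y is a frame homomorphism from Y to X. *)
Record locale_map (X Y : frame) := LocaleMap {
  inv_image :> Y -> X;
  inv_image_top : inv_image (ftop Y) = ftop X;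
  inv_image_meet : forall x y,
    inv_image (fmeet x y) = fmeet (inv_image x) (inv_image y);
  inv_image_sup : forall U, inv_image (fsup U) = fsup (inv_image @` U)
}.

Lemma locale_map_eq X Y (f g : locale_map X Y) : (forall x, f x = g x) -> f = g.
Proof.
case: f g => [f f1 f2 f3] [g g1 g2 g3] /= /funext e.
rewrite e in f1 f2 f3 *.
by congr LocaleMap; exact: Prop_irrelevance.
Qed.

Definition locale_id X : locale_map X X.
Proof. by refine (@LocaleMap X X id _ _ _) => // U; rewrite image_id. Defined.

Definition locale_cmp X Y Z (g : locale_map Y Z) (f : locale_map X Y) :
  locale_map X Z.
Proof.
refine (@LocaleMap X Z (f \o g) _ _ _) => [|x y|U] /=.
- by rewrite !inv_image_top.
- by rewrite !inv_image_meet.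
- by rewrite !inv_image_sup image_comp.
Defined.

Definition Loc_cat : category.
Proof.
by refine (@Category frame locale_map locale_id locale_cmp _ _ _);
  move=> *; exact: locale_map_eq.
Defined.

(* A subset of a power of a frame closed under the pointwise operations. *)
Section SubPowerFrame.
Context (L : frame) (T : Type) (Phi : (T -> L) -> Prop).
Hypothesis Phi_top : Phi (fun=> ftop L).
Hypothesis Phi_meet : forall f g, Phi f -> Phi g ->
  Phi (fun t => fmeet (f t) (g t)).
Hypothesis Phi_sup : forall U : set (T -> L), (forall f, U f -> Phi f) ->
  Phi (fun t => fsup [set f t | f in U]).

Record subpower := SubPower { subpower_fun :> T -> L; subpowerP : Phi subpower_fun }.

Lemma subpower_eq (f g : subpower) : (forall t, f t = g t) -> f = g.
Proof.
case: f g => [f fP] [g gP] /= /funext e; rewrite e in fP *.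
by congr SubPower; exact: Prop_irrelevance.
Qed.

Lemma subpower_sup_subproof (U : set subpower) :
  Phi (fun t => fsup [set (f : subpower) t | f in U]).
Proof.
have := @Phi_sup [set (f : T -> L) | f in U].
rewrite (_ : (fun t => _) = (fun t => fsup [set f t | f in U])); last first.
  by apply: funext => t; rewrite image_comp.
by apply => _ [f _ <-]; exact: subpowerP.
Qed.

Definition subpower_frame : frame.
Proof.
refine (@Frame subpower (fun f g => forall t, fle (f t) (g t))
  (SubPower Phi_top)
  (fun f g => SubPower (Phi_meet (subpowerP f) (subpowerP g)))
  (fun U => SubPower (subpower_sup_subproof U)) _ _ _ _ _ _ _).
- by move=> f t; exact: fle_refl.
- by move=> f g h1 h2; apply: subpower_eq => t; exact: fle_anti.
- by move=> f g h h1 h2 t; exact: fle_trans (h1 t) (h2 t).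
- by move=> f t; exact: fle_top.
- move=> f g h; split=> [h1|[h1 h2] t]; last exact/fle_meet.
  by split=> t; have /fle_meet[] := h1 t.
- move=> U h; split=> [h1 f Uf t|h1 t]; last by apply/fsup_le => _ [f Uf <-]; exact: h1.
  by have /fsup_le := h1 t; apply; exists f.
- move=> f U t; apply: fle_trans (fmeet_sup _ _) _.
  apply/fsup_le => _ [_ [g Ug <-] <-]; apply: fle_sup.
  by exists (SubPower (Phi_meet (subpowerP f) (subpowerP g))) => //; exists g.
Defined.

End SubPowerFrame.

Section ClosedIdeals.
Context {d : Order.disp_t} {B : ctbDistrLatticeType d} (J : zdtopology B).

Implicit Types b c e : B.

Record closed_ideal := ClosedIdeal {
  ideal_set :> B -> Prop;
  ideal_bot : ideal_set \bot;
  ideal_le : forall b c, c <= b -> ideal_set b -> ideal_set c;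
  ideal_join : forall b c, ideal_set b -> ideal_set c -> ideal_set (b `|` c);
  ideal_closed : forall b (P : set B), partitions_of J b P ->
    (forall c, P c -> ideal_set c) -> ideal_set b
}.

Lemma closed_ideal_eq (I K : closed_ideal) : (forall b, I b <-> K b) -> I = K.
Proof.
case: I K => [I i1 i2 i3 i4] [K k1 k2 k3 k4] /= h.
have e : I = K by apply: funext => b; exact/propext.
rewrite e in i1 i2 i3 i4 *.
by congr ClosedIdeal; exact: Prop_irrelevance.
Qed.

Definition ideal_gen (X : set B) : closed_ideal.
Proof.
refine (@ClosedIdeal
  (fun b => forall I : closed_ideal, (forall c, X c -> I c) -> I b) _ _ _ _).
- by move=> I _; exact: ideal_bot.
- by move=> b c cb h I /h; exact: ideal_le.
- by move=> b c h1 h2 I hI; apply: ideal_join; [exact: h1|exact: h2].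
- by move=> b P JP h I hI; apply: (ideal_closed JP) => c Pc; exact: h.
Defined.

Lemma ideal_gen_sub (X : set B) b : X b -> ideal_gen X b.
Proof. by move=> Xb I; exact. Qed.

Lemma partitions_of_meet b e (P : set B) : partitions_of J e P ->
  partitions_of J (e `&` b) (minus0 [set c `&` b | c in P]).
Proof.
move=> [[P0 [Pub Plub] dis] [Q JQ PQ]]; split; last first.
  exists (minus0 [set a | exists q c, [/\ Q q, minus0 [set b; ~` b] c & a = q `&` c]]).
    by apply: zdt_refine => // q _; exact: partition_compl.
  move=> _ [[c Pc <-] cb0]; split => //; exists c, b; split=> //.
    exact: PQ.
  by split; [left|move=> b0; apply: cb0; rewrite b0 meetx0].
split; first by case.
  split=> [_ [[c Pc <-] _]|u ub].
    by apply: leI2 => //; exact: Pub.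
  have : e <= u `|` ~` b.
    apply: Plub => c Pc; rewrite -[c]meetx1 -(joinxC b) meetUr leU2 ?leIr //.
    have [->|/eqP cb0] := eqVneq (c `&` b) \bot; first exact: le0x.
    by apply: ub; split=> //; exists c.
  move=> h; apply: le_trans (leI2 h (lexx b)) _.
  by rewrite meetUl meetCx joinx0 leIl.
move=> _ _ [[c Pc <-] _] [[c' Pc' <-] _] ne.
rewrite meetACA meetxx (dis c c') ?meet0x // => e'; apply: ne; by rewrite e'.
Qed.

Definition ideal_local (K : closed_ideal) b : closed_ideal.
Proof.
refine (@ClosedIdeal (fun c => K (c `&` b)) _ _ _ _).
- by rewrite meet0x; exact: ideal_bot.
- by move=> e c ce; apply: ideal_le; exact: leI2.
- by move=> e c h1 h2; rewrite meetUl; exact: ideal_join.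
- move=> e P JP h; apply: (ideal_closed (partitions_of_meet b JP)) => _ [[c Pc <-] _].
  exact: h.
Defined.

Definition ideal_full : closed_ideal.
Proof. by refine (@ClosedIdeal (fun _ => True) _ _ _ _). Defined.

Definition ideal_meet (I K : closed_ideal) : closed_ideal.
Proof.
refine (@ClosedIdeal (fun b => I b /\ K b) _ _ _ _).
- by split; exact: ideal_bot.
- by move=> b c cb [h1 h2]; split; [exact: ideal_le h1|exact: ideal_le h2].
- by move=> b c [? ?] [? ?]; split; exact: ideal_join.
- by move=> b P JP h; split; apply: (ideal_closed JP) => c /h [].
Defined.

Definition ideal_sup (U : set closed_ideal) : closed_ideal :=
  ideal_gen [set b | exists2 I : closed_ideal, U I & I b].

Definition Idl : frame.
Proof.
refine (@Frame closed_ideal (fun I K => forall b, I b -> K b) ideal_full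
  ideal_meet ideal_sup _ _ _ _ _ _ _).
- by [].
- by move=> I K h1 h2; apply: closed_ideal_eq => b; split; [exact: h1|exact: h2].
- by move=> I K L h1 h2 b /h1 /h2.
- by [].
- move=> I K L; split=> [h|[h1 h2] b Lb]; last by split; [exact: h1|exact: h2].
  by split=> b /h [].
- move=> U K; split=> [h I UI b Ib|h b].
    by apply: h; apply: ideal_gen_sub; exists I.
  by apply => c [I UI Ic]; exact: h Ic.
- move=> I U b [Ib hb].
  have /= := hb (ideal_local (ideal_sup [set ideal_meet I K | K in U]) b).
  rewrite meetxx; apply => c [K UK Kc].
  apply: ideal_gen_sub; exists (ideal_meet I K); first by exists K.
  by split; [exact: ideal_le (leIr _ _) Ib|exact: ideal_le (leIl _ _) Kc].
Defined.

(* I and K have the same intersection with the principal ideal of b. *)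
Definition ideal_beq b (I K : Idl) : Prop :=
  [set c | (I : closed_ideal) c /\ c <= b] = [set c | (K : closed_ideal) c /\ c <= b].

Lemma ideal_beqP b (I K : closed_ideal) :
  ideal_beq b I K <-> forall c, c <= b -> I c <-> K c.
Proof.
split=> [h c cb|h]; last by apply/seteqP; split=> c /= [h1 cb]; split=> //; exact/h.
have := congr1 (fun S : set B => S c) h => /= e.
have hI : I c <-> (I c /\ c <= b) by split=> [|[]].
have hK : K c <-> (K c /\ c <= b) by split=> [|[]].
by rewrite hI e -hK.
Qed.

Lemma ideal_beq_meet b (I I' K K' : Idl) :
  ideal_beq b I I' -> ideal_beq b K K' -> ideal_beq b (fmeet I K) (fmeet I' K').
Proof.
move=> /ideal_beqP h1 /ideal_beqP h2; apply/ideal_beqP => c cb /=.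
by rewrite (h1 c cb) (h2 c cb).
Qed.

Lemma ideal_gen_beq b (X Y : set B) :
  (forall c, X c -> ideal_gen Y (c `&` b)) ->
  (forall c, Y c -> ideal_gen X (c `&` b)) ->
  ideal_beq b (ideal_gen X) (ideal_gen Y).
Proof.
move=> h1 h2; apply/ideal_beqP => c /meet_idPl cb; split=> hc.
  by have /= := hc (ideal_local (ideal_gen Y) b); rewrite cb; exact.
by have /= := hc (ideal_local (ideal_gen X) b); rewrite cb; exact.
Qed.

Lemma ideal_beq_sup (T : Type) (U : set T) b (f g : T -> Idl) :
  (forall t, U t -> ideal_beq b (f t) (g t)) ->
  ideal_beq b (fsup [set f t | t in U]) (fsup [set g t | t in U]).
Proof.
move=> h; apply: ideal_gen_beq => c [_ [t Ut <-] hc]; apply: ideal_gen_sub.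
  exists (g t); first by exists t.
  by have /ideal_beqP/(_ _ (leIr b c)) [h1 _] := h t Ut; apply/h1/(ideal_le (leIl _ _) hc).
exists (f t); first by exists t.
by have /ideal_beqP/(_ _ (leIr b c)) [_ h1] := h t Ut; apply/h1/(ideal_le (leIl _ _) hc).
Qed.

End ClosedIdeals.

Section LocalicCategory.
Context {d : Order.disp_t} {B : ctbDistrLatticeType d} {J : zdtopology B}.
Context {M : monoidType} (A : matched_pair J M).

Local Notation act := (mp_act A).
Local Notation beqM := (beq (mp_bset A)).
Local Notation Idl := (Idl J).

Definition act_ideal (m : M) (I : Idl) : Idl :=
  ideal_gen J [set act m b | b in (I : closed_ideal J)].

Lemma act0 m : act m \bot = \bot.
Proof. by case: (mp_act_hom A m).1. Qed.

Lemma act1 m : act m \top = \top.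
Proof. by case: (mp_act_hom A m).1. Qed.

Lemma actI m b c : act m (b `&` c) = act m b `&` act m c.
Proof. by case: (mp_act_hom A m).1. Qed.

Lemma actU m b c : act m (b `|` c) = act m b `|` act m c.
Proof. by case: (mp_act_hom A m).1. Qed.

Lemma actC m b : act m (~` b) = ~` act m b.
Proof. by case: (mp_act_hom A m).1. Qed.

Lemma act_le m b c : b <= c -> act m b <= act m c.
Proof. by move=> /meet_idPl <-; rewrite actI leIr. Qed.

Lemma act_ideal_cong b m n (I : Idl) :
  beqM b m n -> ideal_beq b (act_ideal m I) (act_ideal n I).
Proof.
move=> h; apply: ideal_gen_beq => _ [c Ic <-].
  rewrite meetC (mp_act_cong c h); apply: ideal_le (leIr _ _) _.
  by apply: ideal_gen_sub; exists c.
rewrite meetC -(mp_act_cong c h); apply: ideal_le (leIr _ _) _.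
by apply: ideal_gen_sub; exists c.
Qed.

Lemma act_ideal_beq b m (I K : Idl) :
  ideal_beq b I K -> ideal_beq (act m b) (act_ideal m I) (act_ideal m K).
Proof.
move=> /ideal_beqP h; apply: ideal_gen_beq => _ [c Ic <-]; rewrite -actI;
  apply: ideal_gen_sub; exists (c `&` b) => //; apply/h; rewrite ?leIr //;
  exact: ideal_le (leIl _ _) Ic.
Qed.

Lemma partitions_of_act m b (P : set B) : partitions_of J b P ->
  partitions_of J (act m b) (minus0 [set act m c | c in P]).
Proof.
move=> [[P0 [Pub Plub] dis] [Q JQ PQ]]; split; last first.
  exists (minus0 [set act m c | c in Q]); first exact: mp_act_minus0.
  by move=> _ [[c Pc <-] ne]; split=> //; exists c => //; exact: PQ.
have [_ _ disQ] := zdt_partition JQ.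
split; first by case.
  split=> [_ [[c Pc <-] _]|u ub]; first exact/act_le/Pub.
  have [_ [_ /(_ (u `|` ~` act m b)) lub] _] := zdt_partition (mp_act_minus0 A m JQ).
  have h : \top <= u `|` ~` act m b.
    apply: lub => _ [[q Qq <-] ne].
    have [Pq|nPq] := pselect (P q).
      by apply: le_trans (leUl _ _); apply: ub; split=> //; exists q.
    apply: le_trans (leUr _ _); rewrite -actC; apply: act_le.
    rewrite lexC; apply: Plub => p Pp; rewrite -disj_leC; apply/eqP; apply: disQ => //.
      exact: PQ.
    by move=> e; apply: nPq; rewrite -e.
  rewrite -[act m b]meet1x; apply: le_trans (leI2 h (lexx _)) _.
  by rewrite meetUl meetCx joinx0 leIl.
move=> _ _ [[c Pc <-] _] [[c' Pc' <-] _] ne.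
by rewrite -actI (dis c c') ?act0 // => e; apply: ne; rewrite e.
Qed.

Definition ideal_preimage (m : M) (K : closed_ideal J) : closed_ideal J.
Proof.
refine (@ClosedIdeal _ _ J (fun b => K (act m b)) _ _ _ _).
- by rewrite act0; exact: ideal_bot.
- by move=> b c cb; apply: ideal_le; exact: act_le.
- by move=> b c h1 h2; rewrite actU; exact: ideal_join.
- move=> b P JP h; apply: (ideal_closed (partitions_of_act m JP)) => _ [[c Pc <-] _].
  exact: h.
Defined.

Lemma act_ideal_top m : act_ideal m (ftop Idl) = ftop Idl.
Proof.
apply: closed_ideal_eq => b; split=> // _; apply: ideal_le (lex1 b) _.
by apply: ideal_gen_sub; exists \top => //; exact: act1.
Qed.

Lemma act_ideal_meet m (I K : Idl) :
  act_ideal m (fmeet I K) = fmeet (act_ideal m I) (act_ideal m K).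
Proof.
apply: closed_ideal_eq => b; split=> [|[hI hK]].
  apply => _ [c [Ic Kc] <-].
  by split; apply: ideal_gen_sub; exists c.
pose G : closed_ideal J := act_ideal m (fmeet I K).
suff : ideal_local G b b by rewrite /= meetxx.
apply: hI => _ [a Ia <-] /=; rewrite meetC.
apply: (hK (ideal_local G (act m a))) => _ [c Kc <-] /=; rewrite -actI.
apply: ideal_gen_sub; exists (c `&` a) => //.
by split; [exact: ideal_le (leIr _ _) Ia|exact: ideal_le (leIl _ _) Kc].
Qed.

Lemma act_ideal_sup m (U : set Idl) :
  act_ideal m (fsup U) = fsup [set act_ideal m I | I in U].
Proof.
apply: closed_ideal_eq => b; split.
  apply => _ [c hc <-].
  pose K : closed_ideal J := fsup [set act_ideal m I | I in U].
  apply: (hc (ideal_preimage m K)) => e [I UI Ie]; apply: ideal_gen_sub.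
  by exists (act_ideal m I); [exists I|apply: ideal_gen_sub; exists e].
apply => c [_ [I UI <-] hc]; apply: hc => _ [e Ie <-].
apply: ideal_gen_sub; exists e => //; apply: ideal_gen_sub.
by exists I.
Qed.

(* The condition that f is a homomorphism of B_J-sets M -> Idl. *)
Definition arrow_cond (f : M -> Idl) : Prop :=
  forall b m n, beqM b m n -> ideal_beq b (f m) (f n).

(* A function of the composable pair (m, n): m is followed by n. *)
Definition pair_cond (f : M * M -> Idl) : Prop :=
  (forall b m m' n, beqM b m m' -> ideal_beq b (f (m, n)) (f (m', n))) /\
  (forall b m n n', beqM b n n' -> ideal_beq (act m b) (f (m, n)) (f (m, n'))).

Lemma arrow_cond_top : arrow_cond (fun=> ftop Idl).
Proof. by []. Qed.

Lemma arrow_cond_meet f g : arrow_cond f -> arrow_cond g ->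
  arrow_cond (fun m => fmeet (f m) (g m)).
Proof. by move=> hf hg b m n h; apply: ideal_beq_meet; [exact: hf|exact: hg]. Qed.

Lemma arrow_cond_sup (U : set (M -> Idl)) : (forall f, U f -> arrow_cond f) ->
  arrow_cond (fun m => fsup [set f m | f in U]).
Proof. by move=> hU b m n h; apply: ideal_beq_sup => f Uf; exact: hU. Qed.

Lemma pair_cond_top : pair_cond (fun=> ftop Idl).
Proof. by []. Qed.

Lemma pair_cond_meet f g : pair_cond f -> pair_cond g ->
  pair_cond (fun u => fmeet (f u) (g u)).
Proof.
move=> [f1 f2] [g1 g2]; split=> *; apply: ideal_beq_meet;
  by [exact: f1|exact: g1|exact: f2|exact: g2].
Qed.

Lemma pair_cond_sup (U : set (M * M -> Idl)) : (forall f, U f -> pair_cond f) ->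
  pair_cond (fun u => fsup [set f u | f in U]).
Proof.
move=> hU; split=> b m n n' h; apply: ideal_beq_sup => f /hU [h1 h2].
  exact: h1.
exact: h2.
Qed.

Definition arrow_frame : frame :=
  subpower_frame arrow_cond_top arrow_cond_meet arrow_cond_sup.

Definition pair_frame : frame :=
  subpower_frame pair_cond_top pair_cond_meet pair_cond_sup.

Definition lc_src : locale_map arrow_frame Idl.
Proof.
refine (@LocaleMap arrow_frame Idl
  (fun I => @SubPower _ _ arrow_cond (fun=> I) (fun _ _ _ _ => erefl)) _ _ _).
- exact: subpower_eq.
- by move=> I K; exact: subpower_eq.
- by move=> U; apply: subpower_eq => m /=; rewrite image_comp /= image_id.
Defined.

Definition lc_tgt : locale_map arrow_frame Idl.
Proof.
refine (@LocaleMap arrow_frame Idl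
  (fun I => @SubPower _ _ arrow_cond (fun m => act_ideal m I)
    (fun b m n h => act_ideal_cong I h)) _ _ _).
- by apply: subpower_eq => m; exact: act_ideal_top.
- by move=> I K; apply: subpower_eq => m; exact: act_ideal_meet.
- by move=> U; apply: subpower_eq => m; rewrite /= image_comp; exact: act_ideal_sup.
Defined.

Definition lc_id : locale_map Idl arrow_frame.
Proof.
by refine (@LocaleMap Idl arrow_frame (fun f => (f : subpower _) 1%g) _ _ _).
Defined.

Lemma lc_comp_subproof (f : arrow_frame) :
  pair_cond (fun u => (f : subpower _) (u.1 * u.2)%g).
Proof.
split=> b m n n' h; apply: (subpowerP (f : subpower _)).
  exact: mp_mul_congl.
exact: mp_mul_congr.
Qed.

Definition lc_comp : locale_map pair_frame arrow_frame.
Proof.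
refine (@LocaleMap pair_frame arrow_frame
  (fun f => SubPower (lc_comp_subproof f)) _ _ _).
- exact: subpower_eq.
- by move=> f g; exact: subpower_eq.
- by move=> U; apply: subpower_eq => u; rewrite /= image_comp.
Defined.

Lemma lc_fst_subproof (f : arrow_frame) :
  pair_cond (fun u => (f : subpower _) u.1).
Proof. by split=> b m n n' h //; exact: (subpowerP (f : subpower _)). Qed.

Definition lc_fst : locale_map pair_frame arrow_frame.
Proof.
refine (@LocaleMap pair_frame arrow_frame
  (fun f => SubPower (lc_fst_subproof f)) _ _ _).
- exact: subpower_eq.
- by move=> f g; exact: subpower_eq.
- by move=> U; apply: subpower_eq => u; rewrite /= image_comp.
Defined.

Lemma lc_snd_subproof (g : arrow_frame) :
  pair_cond (fun u => act_ideal u.1 ((g : subpower _) u.2)).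
Proof.
split=> b m n n' h; first exact: act_ideal_cong.
by apply: act_ideal_beq; exact: (subpowerP (g : subpower _)).
Qed.

Definition lc_snd : locale_map pair_frame arrow_frame.
Proof.
refine (@LocaleMap pair_frame arrow_frame
  (fun g => SubPower (lc_snd_subproof g)) _ _ _).
- by apply: subpower_eq => u; exact: act_ideal_top.
- by move=> f g; apply: subpower_eq => u; exact: act_ideal_meet.
- by move=> U; apply: subpower_eq => u; rewrite /= act_ideal_sup !image_comp.
Defined.

Definition classifying_localic_category : internal_category_data Loc_cat :=
  @InternalCategoryData Loc_cat Idl arrow_frame pair_frame
    lc_src lc_tgt lc_id lc_fst lc_snd lc_comp.

End LocalicCategory.

Record cont_map (X Y : topologicalType) := ContMap {
  cont_fun :> X -> Y;
  cont_funP : continuous cont_fun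
}.

Lemma cont_map_eq X Y (f g : cont_map X Y) : (forall x, f x = g x) -> f = g.
Proof.
case: f g => [f fP] [g gP] /= /funext e; rewrite e in fP *.
by congr ContMap; exact: Prop_irrelevance.
Qed.

Definition cont_id (X : topologicalType) : cont_map X X := ContMap (fun x => @cvg_id _ _).

Definition cont_cmp (X Y Z : topologicalType) (g : cont_map Y Z) (f : cont_map X Y) :
  cont_map X Z.
Proof.
refine (@ContMap X Z (g \o f) _).
by move=> x; apply: continuous_comp; exact: cont_funP.
Defined.

Definition Top_cat : category.
Proof.
by refine (@Category topologicalType cont_map cont_id cont_cmp _ _ _);
  move=> *; exact: cont_map_eq.
Defined.

Section Ultrafilters.
Context {d : Order.disp_t} (B : ctbDistrLatticeType d).
Implicit Types b c : B.

Record ultrafilter := Ultrafilter {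
  uf_set :> B -> Prop;
  uf_top : uf_set \top;
  uf_meet : forall b c, uf_set b -> uf_set c -> uf_set (b `&` c);
  uf_le : forall b c, b <= c -> uf_set b -> uf_set c;
  uf_bot : ~ uf_set \bot;
  uf_compl : forall b, uf_set b \/ uf_set (~` b)
}.

Lemma ultrafilter_eq (U V : ultrafilter) : (forall b, U b <-> V b) -> U = V.
Proof.
case: U V => [U u1 u2 u3 u4 u5] [V v1 v2 v3 v4 v5] /= h.
have e : U = V by apply: funext => b; exact/propext.
rewrite e in u1 u2 u3 u4 u5 *.
by congr Ultrafilter; exact: Prop_irrelevance.
Qed.

HB.instance Definition _ := gen_eqMixin ultrafilter.
HB.instance Definition _ := gen_choiceMixin ultrafilter.

Definition stone_basic b : set ultrafilter := [set U : ultrafilter | U b].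

Lemma stone_cover : \bigcup_(S in range stone_basic) S = setT.
Proof.
apply/seteqP; split=> // U _; exists (stone_basic \top); last exact: uf_top.
by exists \top.
Qed.

Lemma stone_join (S T : set ultrafilter) U :
  range stone_basic S -> range stone_basic T -> S U -> T U ->
  exists R, [/\ range stone_basic R, R U & (R `<=` S `&` T)%classic].
Proof.
move=> [b _ <-] [c _ <-] Ub Uc; exists (stone_basic (b `&` c)); split.
- by exists (b `&` c).
- exact: uf_meet.
- move=> V Vbc; split; [exact: uf_le (leIl _ _) Vbc|exact: uf_le (leIr _ _) Vbc].
Qed.

HB.instance Definition _ :=
  isBaseTopological.Build ultrafilter stone_cover stone_join.

End Ultrafilters.

Section TopologicalCategory.
Context {d : Order.disp_t} {B : ctbDistrLatticeType d} {J : zdtopology B}.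
Context {M : monoidType} (A : matched_pair J M).
Implicit Types (U V : ultrafilter B) (m n : M) (b c : B).

Local Notation act := (mp_act A).
Local Notation beqM := (beq (mp_bset A)).

Definition uf_beq U m n : Prop := exists2 b, U b & beqM b m n.

Definition germ_rel : rel (ultrafilter B * M) :=
  fun x y => `[< x.1 = y.1 /\ uf_beq x.1 x.2 y.2 >].

Lemma germ_relP U m V n :
  reflect (U = V /\ uf_beq U m n) (germ_rel (U, m) (V, n)).
Proof. exact: asboolP. Qed.

Lemma germ_rel_refl : reflexive germ_rel.
Proof.
move=> [U m]; apply/germ_relP; split=> //; exists \top; first exact: uf_top.
exact: beq_refl.
Qed.

Lemma germ_rel_sym : symmetric germ_rel.
Proof.
suff h x y : germ_rel x y -> germ_rel y x by move=> x y; apply/idP/idP; exact: h.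
case: x y => [U m] [V n] /germ_relP [<- [b Ub h]]; apply/germ_relP; split=> //.
by exists b => //; exact: beq_sym.
Qed.

Lemma germ_rel_trans : transitive germ_rel.
Proof.
move=> [V n] [U m] [W p] /germ_relP [<- [b Ub h1]] /germ_relP [<- [c Uc h2]].
apply/germ_relP; split=> //; exists (b `&` c); first exact: uf_meet.
apply: beq_trans (beq_le (leIl _ _) h1) _; exact: beq_le (leIr _ _) h2.
Qed.

Canonical germ_equiv :=
  EquivRel germ_rel germ_rel_refl germ_rel_sym germ_rel_trans.

Definition germ := {eq_quot germ_equiv}.

HB.instance Definition _ := Choice.on germ.

Definition mk_germ U m : germ := \pi_({eq_quot germ_equiv}) (U, m).

Lemma mk_germ_eq U m V n : mk_germ U m = mk_germ V n <-> U = V /\ uf_beq U m n.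
Proof. by split=> [/eqmodP/germ_relP|h]; last exact/eqmodP/germ_relP. Qed.

Definition germ_basic (i : B * M) : set germ := [set mk_germ U i.2 | U in stone_basic i.1].

Lemma mk_germ_repr (x : germ) : mk_germ (repr x).1 (repr x).2 = x.
Proof. by rewrite /mk_germ -surjective_pairing reprK. Qed.

Lemma germ_cover : \bigcup_(S in range germ_basic) S = setT.
Proof.
apply/seteqP; split=> // x _; exists (germ_basic (\top, (repr x).2)).
  by exists (\top, (repr x).2).
by exists (repr x).1; [exact: uf_top|exact: mk_germ_repr].
Qed.

Lemma germ_join (S T : set germ) x :
  range germ_basic S -> range germ_basic T -> S x -> T x ->
  exists R, [/\ range germ_basic R, R x & (R `<=` S `&` T)%classic].
Proof.
move=> [[b m] _ <-] [[c n] _ <-] [U Ub <-] [V Vc].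
move=> /mk_germ_eq [e [a Va h]]; rewrite {}e in Va Vc.
exists (germ_basic (b `&` (c `&` a), m)); split.
- by exists (b `&` (c `&` a), m).
- by exists U => //; apply: uf_meet => //; exact: uf_meet.
move=> _ [W Wbca <-]; split; exists W => //.
- exact: uf_le (leIl _ _) Wbca.
- exact: uf_le (le_trans (leIr _ _) (leIl _ _)) Wbca.
apply/mk_germ_eq; split=> //; exists a => //.
exact: uf_le (le_trans (leIr _ _) (leIr _ _)) Wbca.
Qed.

HB.instance Definition _ := isBaseTopological.Build germ germ_cover germ_join.

Lemma repr_germ U m : (repr (mk_germ U m)).1 = U /\ uf_beq U (repr (mk_germ U m)).2 m.
Proof.
by have /mk_germ_eq [h1 h2] := mk_germ_repr (mk_germ U m); split=> //; rewrite -{1}h1.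
Qed.

Lemma open_stone_basic b : open (stone_basic b).
Proof.
exists [set stone_basic b]; first by move=> _ ->; exists b.
by rewrite bigcup_set1.
Qed.

Lemma open_germ_basic i : open (germ_basic i).
Proof.
exists [set germ_basic i]; first by move=> _ ->; exists i.
by rewrite bigcup_set1.
Qed.

Lemma continuous_stone (T : topologicalType) (f : T -> ultrafilter B) :
  (forall b, open (f @^-1` stone_basic b)) -> continuous f.
Proof.
move=> h; apply/continuousP => _ [D' sD <-]; rewrite preimage_bigcup.
by apply: bigcup_open => S /sD [b _ <-]; exact: h.
Qed.

Lemma continuous_germ (T : topologicalType) (f : T -> germ) :
  (forall i, open (f @^-1` germ_basic i)) -> continuous f.
Proof.
move=> h; apply/continuousP => _ [D' sD <-]; rewrite preimage_bigcup.
by apply: bigcup_open => S /sD [b _ <-]; exact: h.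
Qed.

(* The ultrafilter m_! U. *)
Definition uf_push m U : ultrafilter B.
Proof.
refine (@Ultrafilter _ B (fun b => U (act m b)) _ _ _ _ _).
- by rewrite act1; exact: uf_top.
- by move=> b c h1 h2; rewrite actI; exact: uf_meet.
- by move=> b c bc; apply: uf_le; exact: act_le.
- by rewrite act0; exact: uf_bot.
- by move=> b; rewrite actC; exact: uf_compl.
Defined.

Lemma uf_push_cong U m n : uf_beq U m n -> uf_push m U = uf_push n U.
Proof.
move=> [b Ub h]; apply: ultrafilter_eq => c /=.
split=> hc.
  by apply: (uf_le (leIr (act n c) b)); rewrite -(mp_act_cong c h); exact: uf_meet.
by apply: (uf_le (leIr (act m c) b)); rewrite (mp_act_cong c h); exact: uf_meet.
Qed.

Definition germ_src (x : germ) : ultrafilter B := (repr x).1.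

Definition germ_tgt (x : germ) : ultrafilter B := uf_push (repr x).2 (repr x).1.

Definition germ_id U : germ := mk_germ U 1%g.

Definition composable : set (germ * germ) :=
  [set p | germ_tgt p.1 = germ_src p.2].

Definition germ_comp (p : composable) : germ :=
  mk_germ (germ_src (val p).1) ((repr (val p).1).2 * (repr (val p).2).2)%g.

Lemma germ_srcE U m : germ_src (mk_germ U m) = U.
Proof. exact: (repr_germ U m).1. Qed.

Lemma germ_tgtE U m : germ_tgt (mk_germ U m) = uf_push m U.
Proof.
by have [h1 h2] := repr_germ U m; rewrite /germ_tgt h1; exact: uf_push_cong.
Qed.

Lemma germ_compE U m n (p : composable) :
  val p = (mk_germ U m, mk_germ (uf_push m U) n) ->
  germ_comp p = mk_germ U (m * n)%g.
Proof.
move=> e; rewrite /germ_comp e /= germ_srcE; apply/mk_germ_eq; split=> //.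
have [_ [b Ub h1]] := repr_germ U m.
have [_ [c Uc h2]] := repr_germ (uf_push m U) n.
exists (b `&` act m c); first exact: uf_meet.
apply: beq_trans (beq_le (leIl _ _) (mp_mul_congl _ h1)) _.
exact: beq_le (leIr _ _) (mp_mul_congr _ h2).
Qed.

Lemma germ_src_cont : continuous germ_src.
Proof.
apply: continuous_stone => b.
rewrite (_ : _ @^-1` _ = \bigcup_m germ_basic (b, m)).
  by apply: bigcup_open => m _; exact: open_germ_basic.
apply/seteqP; split=> [x xb|_ [m _ [U Ub <-]]]; last by rewrite /= germ_srcE.
by exists (repr x).2 => //; exists (repr x).1 => //; exact: mk_germ_repr.
Qed.

Lemma germ_tgt_cont : continuous germ_tgt.
Proof.
apply: continuous_stone => b.
rewrite (_ : _ @^-1` _ = \bigcup_m germ_basic (act m b, m)).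
  by apply: bigcup_open => m _; exact: open_germ_basic.
apply/seteqP; split=> [x xb|_ [m _ [U Ub <-]]]; last first.
  have : uf_push m U b by [].
  by rewrite -germ_tgtE.
by exists (repr x).2 => //; exists (repr x).1 => //; exact: mk_germ_repr.
Qed.

Lemma germ_id_cont : continuous germ_id.
Proof.
apply: continuous_germ => -[b m].
rewrite (_ : _ @^-1` _ = \bigcup_(c in [set c | beqM c m 1%g]) stone_basic (b `&` c)).
  by apply: bigcup_open => c _; exact: open_stone_basic.
apply/seteqP; split=> [U [V Vb /mk_germ_eq [e [c Vc h]]]|U [c h Uc]].
  by rewrite e in Vb Vc; exists c => //; exact: uf_meet.
exists U; first exact: uf_le (leIl _ _) Uc.
by apply/mk_germ_eq; split=> //; exists c => //; exact: uf_le (leIr _ _) Uc.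
Qed.

Definition germ_fst (p : composable) : germ := (val p).1.

Definition germ_snd (p : composable) : germ := (val p).2.

Lemma germ_fst_cont : continuous germ_fst.
Proof.
apply/continuousP => S oS; exists (fst @^-1` S)%classic => //.
by apply: open_comp oS => p _; exact: cvg_fst.
Qed.

Lemma germ_snd_cont : continuous germ_snd.
Proof.
apply/continuousP => S oS; exists (snd @^-1` S)%classic => //.
by apply: open_comp oS => p _; exact: cvg_snd.
Qed.

Lemma germ_comp_cont : continuous germ_comp.
Proof.
apply: continuous_germ => -[b r].
rewrite (_ : _ @^-1` _ = \bigcup_(i in [set i : (B * M) * M |
    i.1.1 <= b /\ beqM i.1.1 (i.1.2 * i.2)%g r])
    (germ_fst @^-1` germ_basic i.1 `&` germ_snd @^-1` germ_basic (\top, i.2))%classic).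
  apply: bigcup_open => i _; apply: openI.
    by move/continuousP: germ_fst_cont; apply; exact: open_germ_basic.
  by move/continuousP: germ_snd_cont; apply; exact: open_germ_basic.
apply/seteqP; split=> p.
  move=> [U Ub /esym /mk_germ_eq [e [a Ua h]]]; rewrite e in Ua.
  exists ((b `&` a, (repr (val p).1).2), (repr (val p).2).2).
    by split; [exact: leIl|exact: beq_le (leIr _ _) h].
  split.
    exists (germ_src (val p).1); last exact: mk_germ_repr.
    by rewrite e; exact: uf_meet.
  by exists (repr (val p).2).1; [exact: uf_top|exact: mk_germ_repr].
move=> [[[a m] n] /= [ab h]] [[U Ua e1] [V _ e2]].
rewrite /germ_fst /= in e1; rewrite /germ_snd /= in e2.
have pc : germ_tgt (val p).1 = germ_src (val p).2.
  by have := set_mem (valP p).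
rewrite -e1 -e2 germ_tgtE germ_srcE in pc.
exists U; first exact: uf_le ab Ua.
rewrite (@germ_compE U m n p); last by rewrite pc [LHS]surjective_pairing e1 e2.
by apply/mk_germ_eq; split=> //; exists a => //; exact: beq_sym.
Qed.

Definition classifying_topological_category : internal_category_data Top_cat :=
  @InternalCategoryData Top_cat (ultrafilter B) germ composable
    (ContMap germ_src_cont) (ContMap germ_tgt_cont) (ContMap germ_id_cont)
    (ContMap germ_fst_cont) (ContMap germ_snd_cont) (ContMap germ_comp_cont).

End TopologicalCategory.

(* Main.v *)
Require Import Defs.
From mathcomp Require Import all_boot all_order.
From mathcomp Require Import boolp classical_sets cardinality topology.

Set Implicit Arguments.
Unset Strict Implicit.
Unset Printing Implicit Defensive.

Import Order.Theory.

Local Open Scope classical_set_scope.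
Local Open Scope order_scope.

(** Think of an element [m] of [M] as a family of arrows, one over each point of
    the space of [B], with [m^*] pulling back along the target; a product [m n]
    is [m] followed by [n]. The existence of the elements [b_i], [n_i], [c_i]
    says that every arrow has an inverse, locally given by elements [n] of [M]:
    over [b] the equation [m n = 1] holds, and [n m = 1] holds over some [c] that
    contains the targets of the arrows over [b]. The other conditions are all
    compared with this one, in the form of the predicate [locally_invertible].

    Local inverses are unique where they are defined ([local_inverse_uniq]), so
    an expression which depends on the inverse of [m] can be evaluated locally
    and the values can be glued ([at_inverse]). This yields the cartesian
    closedness of the forgetful functor and the localic groupoid. A homomorphism
    [h : Y -> Z] of the underlying sets extends along [y |-> (1, y)] to an
    equivariant map on [M * Y] by [f (m, y) = m . h (m^-1 . y)], the only
    possible choice, so that the exponentials agree. In the localic category,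
    the inverse images of the maps [(id, inv)] and [(inv, id)] evaluate a
    function of composable pairs at [(m, m^-1)] and at [(m^-1, m)].

    Conversely, it is enough to have closed ideals [I n] with supremum [1], for
    [n] in [M], where [I n] is below the truth value of [m n = 1] and below that
    of [n m = 1] taken at the targets of [m] ([invertible_of_cover]). In a
    localic groupoid, [I n] is the open over which the inverse of [m] equals
    [n]. If the forgetful functor is cartesian closed, the exponentials with
    values in a coinduced set show that [(m, y) |-> (m, m y)] induces a bijection
    between ideal-valued functions of two arrows with a common source and
    ideal-valued functions of composable pairs ([untwist_exists],
    [untwist_inj]), as it does in a groupoid; then [I n] is obtained by
    transporting the truth value of [y = n].

    The étale condition is a restatement of local invertibility, since [m|_b] is
    a partial isomorphism exactly when [m] has a local inverse over [b]
    ([partial_iso_res]). For finite partitions, the ultrafilters are enough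
    points: an arrow of the topological category is invertible iff its
    ultrafilter contains some [b] over which [m] has a local inverse, and if the
    ideal generated by these [b] were proper then some ultrafilter would avoid
    it ([ultrafilter_avoiding]). *)

(** * Closed ideals, covers and truth values *)

Lemma fleP (L : frame) (x y : L) : fle x y <-> fmeet x y = x.
Proof.
have [hx hy] : fle (fmeet x y) x /\ fle (fmeet x y) y.
  exact/fle_meet/fle_refl.
split=> [h|<- //]; apply: fle_anti => //.
by apply/fle_meet; split=> //; exact: fle_refl.
Qed.

Section Covers.
Context {d : Order.disp_t} {B : ctbDistrLatticeType d} (J : zdtopology B).
Implicit Types (b c e : B) (P Q : set B).

Lemma zdt_inhabited : exists Q, J Q.
Proof. by exists (minus0 [set \top; ~` \top]); exact: partition_compl. Qed.

Lemma partitions_of_disj b P Q q : is_partition b P -> J Q -> P `<=` Q ->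
  Q q -> P q \/ b `&` q = \bot.
Proof.
move=> [_ [_ lub] _] JQ PQ Qq; have [Pq|nPq] := pselect (P q); [by left|right].
have [_ _ dis] := zdt_partition JQ.
apply/eqP; rewrite disj_leC; apply: lub => p Pp; rewrite -disj_leC; apply/eqP.
by apply: dis => //; [exact: PQ|move=> e; apply: nPq; rewrite -e].
Qed.

(** The elements that become members of the down-set [L] after cutting them
    along some partition of the topology; this is the least closed ideal
    containing [L]. *)
Definition cover_ideal (L : set B) (L0 : L \bot)
  (Lle : forall b c, c <= b -> L b -> L c) : closed_ideal J.
Proof.
refine (@ClosedIdeal _ _ J
  (fun b => exists2 Q, J Q & forall q, Q q -> L (q `&` b)) _ _ _ _).
- by have [Q JQ] := zdt_inhabited; exists Q => // q _; rewrite meetx0.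
- move=> b c cb [Q JQ h]; exists Q => // q Qq.
  by apply: Lle (h q Qq); apply: leI2.
- move=> b c [Q JQ hQ] [R JR hR].
  have JQR := zdt_refine JQ (fun _ _ => JR).
  (* On [b] a cell of [Q] decides, on its complement a cell of [R] does. *)
  have := zdt_refine JQR (fun _ _ => partition_compl J b).
  set S := minus0 _ => JS; exists S => //.
  move=> _ [[_ [e [[[q [r [Qq Rr ->]]] _] [he _] ->]]] _].
  case: he => ->.
    apply: Lle (hQ q Qq); apply: le_trans (leIl _ _) _.
    by apply: leI2; rewrite ?leIl.
  apply: Lle (hR r Rr); rewrite -meetA; apply: leI2; first exact: leIr.
  by rewrite meetUr meetCx join0x leIr.
- move=> b P [partP [Q JQ PQ]] h.
  have ex c : exists R, J R /\ (P c -> forall q, R q -> L (q `&` c)).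
    have [Pc|nPc] := pselect (P c); first by have [R JR hR] := h c Pc; exists R.
    by have [R JR] := zdt_inhabited; exists R.
  have [R hR] := choice ex.
  exists (minus0 [set a | exists c r, [/\ Q c, R c r & a = c `&` r]]).
    by apply: zdt_refine => // c _; exact: (hR c).1.
  move=> _ [[c [r [Qc Rr ->]]] _].
  have [Pc|bc0] := partitions_of_disj partP JQ PQ Qc.
    by apply: Lle ((hR c).2 Pc r Rr); rewrite [c `&` r]meetC leIl.
  by rewrite meetAC [c `&` b]meetC bc0 meet0x.
Defined.

Lemma ideal_gen_cover (L : set B) b : L \bot ->
  (forall b c, c <= b -> L b -> L c) -> ideal_gen J L b ->
  exists2 Q, J Q & forall q, Q q -> L (q `&` b).
Proof.
move=> L0 Lle /(_ (cover_ideal L0 Lle)); apply => c Lc.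
have [Q JQ] := zdt_inhabited; exists Q => // q _.
exact: Lle (leIr _ _) Lc.
Qed.

(** The truth value of the equation [x = y], in the frame of closed ideals. *)
Definition eq_ideal (X : bset J) (x y : X) : closed_ideal J.
Proof.
refine (@ClosedIdeal _ _ J (fun b => beq (bset_str X) b x y) _ _ _ _).
- exact: beq_bot.
- by move=> b c; exact: beq_le.
- by move=> b c; exact: beq_join.
- move=> b P [partP [Q JQ PQ]] h; apply: (beq_sep_le JQ) => q Qq.
  have [Pq|->] := partitions_of_disj partP JQ PQ Qq; last exact: beq_bot.
  exact: beq_le (leIr _ _) (h q Pq).
Defined.

Lemma eq_ideal_cong (X : bset J) b (x x' y y' : X) :
  beq (bset_str X) b x x' -> beq (bset_str X) b y y' ->
  ideal_beq b (eq_ideal x y) (eq_ideal x' y').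
Proof.
move=> hx hy; apply/ideal_beqP => c cb /=.
have hx' := beq_le cb hx; have hy' := beq_le cb hy.
split=> h.
  exact: beq_trans (beq_sym hx') (beq_trans h hy').
exact: beq_trans hx' (beq_trans h (beq_sym hy')).
Qed.

(** Ideals that agree on the cells of a partition are equal because they are
    closed; given ideals on the cells are glued by requiring membership cell by
    cell. *)
Lemma ideal_is_beq : is_beq J (@ideal_beq _ _ J).
Proof.
split=> //.
- by move=> b I K L h1 h2; exact: etrans h1 h2.
- move=> I K; apply/ideal_beqP => c; rewrite lex0 => /eqP ->.
  by split=> _; exact: ideal_bot.
- move=> b c I K cb /ideal_beqP h; apply/ideal_beqP => e ec; apply: h.
  exact: le_trans cb.
- move=> P I K JP h.
  suff sub (I' K' : closed_ideal J) : (forall b, P b -> ideal_beq b I' K') ->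
      forall c, I' c -> K' c.
    by apply: closed_ideal_eq => c; split; apply: sub => // b /h.
  move=> {}h c Ic; rewrite -[c]meet1x.
  have Jtop : partitions_of J \top P by split; [exact: zdt_partition JP|exists P].
  apply: (ideal_closed (partitions_of_meet c Jtop)) => _ [[b Pb <-] _].
  have /ideal_beqP/(_ _ (leIl b c)) [h1 _] := h b Pb.
  by apply: h1; exact: ideal_le (leIr _ _) Ic.
- move=> P I JP; have [_ _ dis] := zdt_partition JP.
  pose K : closed_ideal J := ideal_gen J
    [set c | forall b, P b -> (I b : closed_ideal J) (c `&` b)].
  exists K => b Pb; apply/ideal_beqP => c cb; split.
    rewrite -{2}(meet_idPl cb).
    by move=> /(_ (ideal_local (I b : closed_ideal J) b)); apply => e; exact.
  move=> Ic; apply: ideal_gen_sub => b' Pb'.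
  have [<-|/eqP ne] := eqVneq b b'.
    by rewrite (meet_idPl cb).
  suff -> : c `&` b' = \bot by exact: ideal_bot.
  by apply/eqP; rewrite -lex0 -(dis b b' Pb Pb' ne) leI2.
Qed.

Definition Idl_bset : bset J := BSet (bset_of_beq ideal_is_beq).

Lemma beq_Idl b (I K : Idl_bset) :
  beq (bset_str Idl_bset) b I K <-> ideal_beq b I K.
Proof. exact: beq_of_beq. Qed.

End Covers.

(** * Local inverses *)

Section LocalInverses.
Context {d : Order.disp_t} {B : ctbDistrLatticeType d} {J : zdtopology B}.
Context {M : monoidType} (A : matched_pair J M).
Implicit Types (m n p : M) (b c e : B).

Local Notation act := (mp_act A).
Local Notation beqM := (beq (mp_bset A)).

Lemma act_congr b m n c : beqM b m n -> b <= act m c -> b <= act n c.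
Proof.
move=> h; rewrite !leEmeet => /eqP hb.
by apply/eqP; rewrite -(mp_act_cong c h).
Qed.

Lemma le_act_unit b m c : beqM b m 1%g -> c <= b -> c <= act m c.
Proof.
move=> h cb; apply: (@act_congr _ 1%g); last by rewrite mp_act1.
exact/beq_sym/(beq_le cb).
Qed.

Lemma ideal_beq_trans b (I K L : Idl J) :
  ideal_beq b I K -> ideal_beq b K L -> ideal_beq b I L.
Proof. exact: etrans. Qed.

Lemma ideal_beq_le b c (I K : Idl J) :
  c <= b -> ideal_beq b I K -> ideal_beq c I K.
Proof. by move=> cb /beq_Idl h; apply/beq_Idl; exact: beq_le h. Qed.

Lemma act_idealM m n (I : Idl J) :
  act_ideal A (m * n)%g I = act_ideal A m (act_ideal A n I).
Proof.
apply: closed_ideal_eq => b; split.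
  apply => _ [c Ic <-]; rewrite mp_actM; apply: ideal_gen_sub.
  by exists (act n c) => //; apply: ideal_gen_sub; exists c.
apply => _ [c hc <-].
apply: (hc (ideal_preimage A m (act_ideal A (m * n)%g I))) => _ [e Ie <-] /=.
by apply: ideal_gen_sub; exists e => //; rewrite mp_actM.
Qed.

Lemma act_ideal1 (I : Idl J) : act_ideal A 1%g I = I.
Proof.
apply: closed_ideal_eq => b; split; last first.
  by move=> Ib; apply: ideal_gen_sub; exists b => //; rewrite mp_act1.
by apply => _ [c Ic <-]; rewrite mp_act1.
Qed.

Lemma act_ideal_le m (I K : closed_ideal J) :
  (forall b, I b -> K b) -> forall b, act_ideal A m I b -> act_ideal A m K b.
Proof.
move=> h b; apply => _ [c Ic <-]; apply: ideal_gen_sub.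
by exists c => //; exact: h.
Qed.

(** Over [b] the arrows of [m] are inverse to those of [n]; the equation
    [n m = 1] lives at the targets of [m], hence over some [c] whose
    pull-back along [m] contains [b]. *)
Definition local_inverse m b n c : Prop :=
  [/\ b <= act m c, beqM b (m * n)%g 1%g & beqM c (n * m)%g 1%g].

Lemma local_inverse_le m b b' n c :
  b' <= b -> local_inverse m b n c -> local_inverse m b' n c.
Proof.
by move=> bb [h1 h2 h3]; split=> //; [exact: le_trans h1|exact: beq_le h2].
Qed.

Lemma local_inverse_one : local_inverse 1%g \top 1%g \top.
Proof. by split; rewrite ?mp_act1 ?mulg1 //; exact: beq_refl. Qed.

(** Two local inverses agree because [n = n (m n') = (n m) n' = n'], the first
    step being valid over [n^* b'] and the last one over [c]. *)
Lemma local_inverse_uniq m b n c b' n' c' :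
  local_inverse m b n c -> local_inverse m b' n' c' ->
  b `&` b' <= act m (c `&` act n b') /\ beqM (c `&` act n b') n n'.
Proof.
move=> [hb mn nm] [_ mn' _]; split.
  rewrite actI lexI; apply/andP; split; first exact: le_trans (leIl _ _) hb.
  rewrite -mp_actM; apply: le_trans (le_act_unit mn (leIl b b')) _.
  by apply: act_le; exact: leIr.
apply: (@beq_trans _ _ _ _ _ _ _ (n * (m * n'))%g).
  apply: beq_le (leIr _ _) _; apply: beq_sym.
  by have := mp_mul_congr n mn'; rewrite mulg1.
rewrite mulgA; apply: beq_le (leIl _ _) _.
by have := mp_mul_congl n' nm; rewrite mul1g.
Qed.

Lemma local_inverse_cong m m' e b n c : beqM e m m' ->
  local_inverse m b n c -> local_inverse m' (e `&` b) n (c `&` act n e).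
Proof.
move=> em [hb mn nm]; split.
- apply: (@act_congr _ m); first exact: beq_le (leIl _ _) em.
  rewrite actI lexI; apply/andP; split; first exact: le_trans (leIr _ _) hb.
  rewrite -mp_actM; apply: le_trans (le_act_unit mn (leIr b e)) _.
  by apply: act_le; exact: leIl.
- apply: beq_trans (beq_le (leIr _ _) mn).
  exact: beq_le (leIl _ _) (beq_sym (mp_mul_congl _ em)).
- apply: beq_trans (beq_le (leIl _ _) nm).
  exact: beq_le (leIr _ _) (beq_sym (mp_mul_congr _ em)).
Qed.

(** The inverse of a product is the product of the inverses in the opposite
    order; its two equations are localised at the intermediate object. *)
Lemma local_inverseM p m a q d' b n c :
  local_inverse p a q d' -> local_inverse m b n c ->
  local_inverse (p * m)%g (a `&` act p b) (n * q)%g (c `&` act n d').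
Proof.
move=> [ha pq qp] [hb mn nm]; split.
- rewrite actI !mp_actM lexI; apply/andP; split.
    by apply: le_trans (leIr _ _) _; exact: act_le.
  have h : b `&` d' <= act m (act n d').
    rewrite -mp_actM; apply: le_trans (le_act_unit mn (leIl b d')) _.
    by apply: act_le; exact: leIr.
  apply: le_trans (act_le A p h); rewrite actI meetC; exact: leI2.
- rewrite -mulgA (mulgA m); apply: beq_trans (beq_le (leIl _ _) pq).
  apply: beq_le (leIr _ _) _; apply: mp_mul_congr.
  by have := mp_mul_congl q mn; rewrite mul1g.
- rewrite -mulgA (mulgA q); apply: beq_trans (beq_le (leIl _ _) nm).
  apply: beq_le (leIr _ _) _; apply: mp_mul_congr.
  by have := mp_mul_congl m qp; rewrite mul1g.
Qed.

Definition invertible_part m : set B :=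
  [set b | exists n c, local_inverse m b n c].

Lemma invertible_part_le m b c :
  c <= b -> invertible_part m b -> invertible_part m c.
Proof. by move=> cb [n [e h]]; exists n, e; exact: local_inverse_le h. Qed.

Lemma invertible_part_bot m : invertible_part m \bot.
Proof.
exists 1%g, \bot; split; first exact: le0x.
  exact: beq_bot.
exact: beq_bot.
Qed.

Definition locally_invertible : Prop :=
  forall m, exists2 Q, J Q & Q `<=` invertible_part m.

(** The right-hand side unfolds what it means for a generated ideal to contain
    the top; the left-hand side is what can be proved by minimality of generated
    ideals, or by means of ultrafilters. *)
Lemma locally_invertibleP :
  (forall m, ideal_gen J (invertible_part m) \top) <-> locally_invertible.
Proof.
split=> h m.
  have [Q JQ hQ] := ideal_gen_cover (@invertible_part_bot m)
    (@invertible_part_le m) (h m).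
  by exists Q => // q /hQ; rewrite meetx1.
have [Q JQ hQ] := h m.
have Jtop : partitions_of J \top Q by split; [exact: zdt_partition JQ|exists Q].
by apply: (ideal_closed Jtop) => q Qq; apply: ideal_gen_sub; exact: hQ.
Qed.

Lemma locally_invertible_indexedP :
  (forall m, exists (I : Type) (b : I -> B) (n : I -> M) (c : I -> B),
     J (range b) /\
     forall i, [/\ b i <= act m (c i), beqM (b i) (m * n i)%g 1%g &
                   beqM (c i) (n i * m)%g 1%g])
  <-> locally_invertible.
Proof.
split=> h m.
  have [I [b [n [c [Jb hb]]]]] := h m.
  by exists (range b) => // _ [i _ <-]; exists (n i), (c i); exact: hb.
have [Q JQ hQ] := h m.
have /choice [f hf] : forall q : Q, exists nc, local_inverse m (val q) nc.1 nc.2.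
  by move=> q; have [n [c ?]] := hQ _ (set_mem (valP q)); exists (n, c).
exists Q, val, (fun q => (f q).1), (fun q => (f q).2); split; last exact: hf.
suff -> : range (val : Q -> B) = Q by [].
apply/seteqP; split=> [_ [q _ <-]|q Qq]; first exact: (set_mem (valP q)).
by exists (exist _ q (mem_set Qq)).
Qed.

(** The ideal [I n] stands for the part where the inverse of [m] is [n]. The
    second condition gives the [c] of a local inverse only after a further
    localisation, which the passage to the generated ideal absorbs. *)
Lemma invertible_of_cover m (I : M -> Idl J) :
  (forall n b, (I n : closed_ideal J) b -> beqM b (m * n)%g 1%g /\
     (act_ideal A m (@eq_ideal _ _ J (regular_bmset A) (n * m)%g 1%g)
        : closed_ideal J) b) ->
  (fsup (range I) : closed_ideal J) \top ->
  ideal_gen J (invertible_part m) \top.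
Proof.
move=> hI; apply => b [_ [n _ <-] Ib]; have [mn hb] := hI n b Ib.
rewrite -[b]meetxx.
apply: (hb (ideal_local (ideal_gen J (invertible_part m)) b)) => _ [c nm <-].
apply: ideal_gen_sub; exists n, c; split=> //; first exact: leIl.
exact: beq_le (leIr _ _) mn.
Qed.

(** * Evaluation at the inverse *)

(** A function of [n] which depends on [n] as an expression in elements that
    live over the targets of [m]; such a function can be evaluated at the
    inverse of [m]. *)
Definition twisted (X : bset J) m (phi : M -> X) : Prop :=
  forall c n n', beqM c n n' ->
    beq (bset_str X) (act m c) (phi n) (phi n').

Section Evaluation.
Hypothesis inv : locally_invertible.
Context (X : bset J).
Local Notation beqX := (beq (bset_str X)).

Lemma local_inverse_sep m e (x y : X) :
  (forall b n c, local_inverse m b n c -> beqX (e `&` b) x y) -> beqX e x y.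
Proof.
move=> h; have [Q JQ hQ] := inv m; apply: (beq_sep_le JQ) => b /hQ [n [c hb]].
exact: h hb.
Qed.

(** The values [phi n] at two local inverses agree on the overlap, because the
    local inverses do and [phi] is compatible with equality at the targets. *)
Lemma at_inverse_subproof m (phi : M -> X) : twisted m phi ->
  exists z, forall b n c, local_inverse m b n c -> beqX b z (phi n).
Proof.
move=> tw; have [Q JQ hQ] := inv m.
have /choice [f hf] : forall q, exists n, Q q -> exists c, local_inverse m q n c.
  move=> q; have [/hQ [n [c h]]|nQ] := pselect (Q q); last by exists 1%g.
  by exists n => _; exists c.
have [z hz] := beq_glue (bset_str X) (fun q => phi (f q)) JQ.
exists z => b n c hb; apply: (beq_sep_le JQ) => q Qq.
have [c' hq] := hf q Qq; apply: beq_trans (beq_le (leIr _ _) (hz q Qq)) _.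
have [le eq] := local_inverse_uniq hq hb; rewrite meetC.
exact: beq_le le (tw _ _ _ eq).
Qed.

Definition at_inverse m (phi : M -> X) (tw : twisted m phi) : X :=
  projT1 (cid (at_inverse_subproof tw)).

Lemma at_inverseE m (phi : M -> X) (tw : twisted m phi) b n c :
  local_inverse m b n c -> beqX b (at_inverse tw) (phi n).
Proof. by rewrite /at_inverse; case: cid => z; exact. Qed.

Lemma at_inverse_eq m (phi : M -> X) (tw : twisted m phi) z :
  (forall b n c, local_inverse m b n c -> beqX b z (phi n)) ->
  at_inverse tw = z.
Proof.
move=> h; have : beqX \top (at_inverse tw) z; last by rewrite /beq bop_top.
apply: (local_inverse_sep (m := m)) => b n c hb; rewrite meet1x.
exact: beq_trans (at_inverseE tw hb) (beq_sym (h b n c hb)).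
Qed.

Lemma at_inverse_cong m m' (phi phi' : M -> X) (tw : twisted m phi)
    (tw' : twisted m' phi') e :
  beqM e m m' ->
  (forall b n c, local_inverse m b n c -> beqX (e `&` b) (phi n) (phi' n)) ->
  beqX e (at_inverse tw) (at_inverse tw').
Proof.
move=> em h; apply/beq_sym; apply: (local_inverse_sep (m := m)) => b n c hb.
apply: beq_trans (at_inverseE tw' (local_inverse_cong em hb)) _.
apply: beq_trans (beq_sym (h b n c hb)) _.
exact: beq_le (leIr _ _) (beq_sym (at_inverseE tw hb)).
Qed.

End Evaluation.
End LocalInverses.

(** * Exponentials *)

Section Exponentials.
Context {d : Order.disp_t} {B : ctbDistrLatticeType d} {J : zdtopology B}.
Context {M : monoidType} (A : matched_pair J M).
Implicit Types (m n p : M) (b c e : B).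

Local Notation act := (mp_act A).
Local Notation beqM := (beq (mp_bset A)).
Local Notation R := (regular_bmset A).

(** The comparison [Z^Y -> UZ^UY] is restriction of a homomorphism
    [M * Y -> Z] along [y |-> (1, y)]; this is its being an isomorphism. *)
Definition unit_restriction_iso : Prop :=
  forall Y Z : bmset A,
    (forall h : bset_hom Y Z, exists f : bm_hom (prod_bmset R Y) Z,
       forall y, f ((1%g : M), y) = h y) /\
    (forall b (f g : bm_hom (prod_bmset R Y) Z),
       (forall y, beq (bset_str Z) b (f ((1%g : M), y)) (g ((1%g : M), y))) ->
       exp_beq b f g).

Lemma cartesian_closed_forgetfulP :
  is_cartesian_closed_functor (BMSet_cartesian_closed A)
    (BSet_cartesian_closed J) (forgetful A) <-> unit_restriction_iso.
Proof.
have cmpE (X Y : bmset A) : product_comparison (BMSet_cartesian_closed A)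
    (BSet_cartesian_closed J) (forgetful A) X Y = bset_id (prod_bset X Y).
  by apply: bset_hom_eq => -[x y].
split=> [[_ h] Y Z|h].
  have [|g [gl gr]] := h Y Z (bset_id (prod_bset (exp_bmset Z Y) Y)).
    by rewrite cmpE; split; exact: bset_hom_eq.
  split=> [k|b f f' e].
    exists ((g : bset_hom _ _) k) => y.
    have /= := congr1 (fun k' : bset_hom (exp_bset Z Y) (exp_bset Z Y) => k' k y) gr.
    by [].
  apply/beq_exp_bmset.
  have gE (f0 : exp_bmset Z Y) : exists2 k : exp_bset Z Y,
      (g : bset_hom (exp_bset Z Y) (exp_bmset Z Y)) k = f0 &
      forall y, k y = (f0 : bm_hom _ _) ((1%g : M), y).
    have := congr1 (fun k : bset_hom (exp_bmset Z Y) (exp_bmset Z Y) => k f0) gl.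
    by move=> /= e0; eexists; [exact: e0|].
  have [k kf kE] := gE f; have [k' kf' kE'] := gE f'.
  rewrite -kf -kf'; apply: bset_funP; apply/beq_exp => y.
  by rewrite kE kE'; exact: e.
split.
  split; first by exists (bset_id (unit_bset J)); split; apply: bset_hom_eq => -[].
  move=> X Y; rewrite cmpE; exists (bset_id (prod_bset X Y)).
  by split; exact: bset_hom_eq.
move=> Y Z k; rewrite cmpE => -[_ kE].
have {}kE u : (k : bset_hom _ _) u = u.
  exact: (congr1 (fun k' : bset_hom _ _ => k' u) kE).
set C := curry _ _.
have CE (f : exp_bmset Z Y) y : (C : bset_hom (exp_bmset Z Y) (exp_bset Z Y)) f y
    = (f : bm_hom _ _) ((1%g : M), y) by rewrite /= kE.
have [surj refl] := h Y Z.
pose g0 (k' : exp_bset Z Y) : exp_bmset Z Y := projT1 (cid (surj k')).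
have g0E k' y : g0 k' ((1%g : M), y) = k' y by rewrite /g0; case: cid.
have g0P b k1 k2 : beq (bset_str (exp_bset Z Y)) b k1 k2 ->
    beq (bset_str (exp_bmset Z Y)) b (g0 k1) (g0 k2).
  move=> /beq_exp e; apply/beq_exp_bmset; apply: refl => y.
  by rewrite !g0E; exact: e.
exists (BSetHom g0P); split; apply: bset_hom_eq.
  move=> f; pose f' := g0 ((C : bset_hom (exp_bmset Z Y) (exp_bset Z Y)) f).
  have : beq (bset_str (exp_bmset Z Y)) \top f' f.
    apply/beq_exp_bmset; apply: refl => y; rewrite g0E CE.
    exact: beq_refl.
  by rewrite {1}/beq bop_top.
by move=> k'; apply: bset_hom_eq => y; rewrite -[RHS]g0E -[RHS]CE.
Qed.

(** The extension of [h] has to satisfy [f (m, y) = m . h (m^-1 . y)]. *)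
Lemma unit_restriction_iso_of_local_inverses :
  locally_invertible A -> unit_restriction_iso.
Proof.
move=> inv Y Z; split=> [h|b f g fg m y]; last first.
  apply: (local_inverse_sep inv (m := m)) => e n c [_ mn _].
  have comp (k : bm_hom (prod_bmset R Y) Z) : beq (bset_str Z) e (k (m, y))
      (bm_act m (k ((1%g : M), bm_act n y))).
    rewrite -(bm_funE k m ((1%g : M), bm_act n y)) /= mulg1 -bm_actM.
    apply: bset_funP; apply/beq_prod; split; first exact: beq_refl.
    by apply: beq_sym; have := bm_congl y mn; rewrite bm_act1.
  apply: beq_trans (beq_le (leIr _ _) (comp f)) _.
  apply: beq_trans (beq_le (leIl _ _) (bm_congr m (fg (bm_act n y)))) _.
  exact: beq_le (leIr _ _) (beq_sym (comp g)).
have tw m y : twisted A m (fun n => bm_act m (h (bm_act n y))).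
  by move=> c n n' e; apply: bm_congr; apply: bset_funP; exact: bm_congl.
pose f0 (u : M * Y) : Z := at_inverse inv (tw u.1 u.2).
have f0P b (u v : prod_bset R Y) : beq (bset_str (prod_bset R Y)) b u v ->
    beq (bset_str Z) b (f0 u) (f0 v).
  case: u v => [m y] [m' y'] /beq_prod /= [hm hy].
  apply: (at_inverse_cong inv _ _ hm) => e n c [_ mn _] /=.
  apply: beq_trans (beq_le (leIl _ _) (bm_congl _ hm)) _.
  (* [y = y'] holds over [b], hence [n y = n y'] over [n^* b], and [m n = 1]
     brings this back to [b]. *)
  have := bm_congr m' (bset_funP h (bm_congr n hy)); apply: beq_le.
  apply: (@act_congr _ _ _ _ A _ m); first exact: beq_le (leIl _ _) hm.
  rewrite -mp_actM; apply: le_trans (le_act_unit mn (leIr e b)) _.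
  by apply: act_le; exact: leIl.
have f0E p (u : prod_bmset R Y) : f0 (bm_act p u) = bm_act p (f0 u).
  case: u => [m y]; rewrite /f0 /=.
  suff : beq (bset_str Z) \top (at_inverse inv (tw (p * m)%g (bm_act p y)))
      (bm_act p (at_inverse inv (tw m y))) by rewrite {1}/beq bop_top.
  apply: (local_inverse_sep inv (m := p)) => a q d' hp; rewrite meet1x.
  have [Q JQ hQ] := inv m; apply: (mp_act_sep (A := A) (m := p) JQ) => b /hQ [n [c hm]].
  apply: beq_trans (at_inverseE inv (tw _ _) (local_inverseM hp hm)) _ => /=.
  have := bm_congr p (at_inverseE inv (tw m y) hm) => /= e.
  apply: beq_trans (beq_sym (beq_le (leIr _ _) e)).
  have -> : bm_act (n * q)%g (bm_act p y) = bm_act n (bm_act (q * p)%g y).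
    by rewrite -!bm_actM mulgA.
  rewrite bm_actM; have [le _ _] := local_inverseM hp hm.
  have [_ _ qp] := hp.
  have qpy : beq (bset_str Y) d' (bm_act (q * p)%g y) y.
    by have := bm_congl y qp; rewrite bm_act1.
  have := bm_congr p (bm_congr m (bset_funP h (bm_congr n qpy))).
  apply: beq_le; apply: le_trans le _; rewrite mp_actM.
  by do 2!apply: act_le; exact: leIr.
exists (@BMHom _ _ _ _ A (prod_bmset R Y) Z (BSetHom f0P) f0E) => y /=.
have := at_inverseE inv (tw 1%g y) (local_inverse_one A); rewrite {1}/beq bop_top.
by rewrite !bm_act1.
Qed.

(** ** Coinduced sets *)

(** The right adjoint to the forgetful functor: homomorphisms [M -> X] of
    sets over the Boolean algebra, on which [M] acts by right translation. *)
Section Coinduced.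
Variable X : bset J.
Local Notation E := (bset_hom (BSet (mp_bset A)) X).

Definition coind_beq b (f g : E) : Prop :=
  forall m, beq (bset_str X) (act m b) (f m) (g m).

Lemma coind_is_beq : is_beq J coind_beq.
Proof.
split.
- by move=> b f m; exact: beq_refl.
- by move=> b f g h m; exact/beq_sym/h.
- by move=> b f g k h1 h2 m; exact: beq_trans (h1 m) (h2 m).
- by move=> f g m; rewrite act0; exact: beq_bot.
- by move=> b c f g cb h m; apply: beq_le (h m); exact: act_le.
- move=> P f g JP h; apply: bset_hom_eq => m.
  by apply: (beq_sep (mp_act_minus0 A m JP)) => _ [[b Pb <-] _]; exact: h.
- move=> P f JP; have [_ _ dis] := zdt_partition JP.
  have ex m : exists z, forall b, P b -> beq (bset_str X) (act m b) z (f b m).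
    (* The cells [m^* b] determine [b] as soon as they are not zero. *)
    have /choice [pick hp] a : exists b, (exists2 c, P c & act m c = a) ->
        P b /\ act m b = a.
      have [[b Pb e]|n] := pselect (exists2 c, P c & act m c = a); last by exists a.
      by exists b.
    have [z hz] := beq_glue (bset_str X) (fun a => f (pick a) m)
      (mp_act_minus0 A m JP).
    exists z => b Pb; have [->|/eqP ne] := eqVneq (act m b) \bot.
      exact: beq_bot.
    have [Pp ep] : P (pick (act m b)) /\ act m (pick (act m b)) = act m b.
      by apply: hp; exists b.
    have <- : pick (act m b) = b.
      apply: contra_notP ne => /(dis _ _ Pp Pb) e.
      by rewrite -(meetxx (act m b)) -{1}ep -actI e act0.
    by rewrite ep; apply: hz; split=> //; exists b.
  have [g hg] := choice ex.
  have gP c m n : beqM c m n -> beq (bset_str X) c (g m) (g n).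
    move=> h; have Jm := mp_act_minus0 A m JP.
    apply: (beq_sep_le Jm) => _ [[b Pb <-] _].
    apply: beq_trans (beq_le (leIr _ _) (hg m b Pb)) _.
    apply: beq_trans (beq_le (leIl _ _) (bset_funP (f b) h)) _.
    rewrite (mp_act_cong b h); apply: beq_le (leIr _ _) _.
    exact/beq_sym/hg.
  by exists (@BSetHom _ _ _ (BSet (mp_bset A)) X g gP) => b Pb m; exact: hg.
Qed.

Lemma coind_act_subproof n (f : E) b m m' :
  beqM b m m' -> beq (bset_str X) b (f (m * n)%g) (f (m' * n)%g).
Proof. by move=> h; apply: bset_funP; exact: mp_mul_congl. Qed.

Definition coind_act n (f : E) : E :=
  @BSetHom _ _ _ (BSet (mp_bset A)) X _ (coind_act_subproof n f).

Definition coinduced : bmset A.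
Proof.
refine (@BMSet _ _ _ _ A (BSet (bset_of_beq coind_is_beq)) coind_act _ _ _ _).
- by move=> f; apply: bset_hom_eq => m /=; rewrite mulg1.
- by move=> m n f; apply: bset_hom_eq => k /=; rewrite mulgA.
- move=> b m n f h; apply/beq_of_beq => k /=; apply: bset_funP.
  exact: mp_mul_congr.
- move=> b m f g /beq_of_beq h; apply/beq_of_beq => k /=.
  by rewrite -mp_actM; exact: h.
Defined.

Lemma beq_coinduced b (f g : coinduced) :
  beq (bset_str coinduced) b f g <-> coind_beq b f g.
Proof. exact: beq_of_beq. Qed.

End Coinduced.

(** ** Untwisting *)

Local Notation MM := (prod_bset (BSet (mp_bset A)) (BSet (mp_bset A))).

(** A homomorphism from [M * M] to a coinduced set is the same thing as a
    homomorphism [F] of the underlying sets; restricting the former along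
    [y |-> (1, y)] amounts to precomposing [F] with [(m, y) |-> (m, m y)].
    So the assumption says that this map identifies pairs of arrows with a
    common source with composable pairs of arrows. *)
Lemma untwist_exists (X : bset J) (H : M -> M -> X) : unit_restriction_iso ->
  (forall b m m' n, beqM b m m' -> beq (bset_str X) b (H m n) (H m' n)) ->
  (forall m, twisted A m (H m)) ->
  exists F : bset_hom MM X, forall m n, F (m, (m * n)%g) = H m n.
Proof.
move=> cc Hl Hr.
have [/(_ _) surj _] := cc R (coinduced X).
have hP b n n' : beqM b n n' ->
  beq (bset_str (coinduced X)) b
    (@BSetHom _ _ _ (BSet (mp_bset A)) X (H^~ n) (fun b m m' => @Hl b m m' n))
    (@BSetHom _ _ _ (BSet (mp_bset A)) X (H^~ n') (fun b m m' => @Hl b m m' n')).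
  by move=> h; apply/beq_coinduced => m /=; exact: Hr.
have [f fE] := surj (@BSetHom _ _ _ R (coinduced X) _ hP).
have FP b (u v : MM) : beq (bset_str MM) b u v ->
    beq (bset_str X) b ((f u : bset_hom _ _) (1%g : M))
                       ((f v : bset_hom _ _) (1%g : M)).
  move=> h; have /beq_coinduced /(_ 1%g) : beq _ b (f u) (f v) := bset_funP f h.
  by rewrite mp_act1.
exists (BSetHom FP) => m n /=.
have := bm_funE f m ((1%g : M), (n : M)); rewrite /= mulg1 => ->.
by rewrite fE /= mul1g.
Qed.

Lemma untwist_inj (X : bset J) (F G : bset_hom MM X) : unit_restriction_iso ->
  (forall m n, F (m, (m * n)%g) = G (m, (m * n)%g)) -> forall u, F u = G u.
Proof.
move=> cc FG; have [_ refl] := cc R (coinduced X).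
have hom1 (K : bset_hom MM X) (u : MM) b (p p' : M) : beqM b p p' ->
    beq (bset_str X) b (K ((p * u.1)%g, (p * u.2)%g))
                       (K ((p' * u.1)%g, (p' * u.2)%g)).
  move=> h; apply: bset_funP; apply/beq_prod; split; exact: mp_mul_congl.
pose f0 (K : bset_hom MM X) (u : MM) : coinduced X :=
  @BSetHom _ _ _ (BSet (mp_bset A)) X _ (hom1 K u).
have f0P K b u v : beq (bset_str MM) b u v ->
    beq (bset_str (coinduced X)) b (f0 K u) (f0 K v).
  move=> /beq_prod [h1 h2]; apply/beq_coinduced => m /=; apply: bset_funP.
  by apply/beq_prod; split; exact: mp_mul_congr.
have f0E K p u : @BSetHom _ _ _ MM (coinduced X) _ (@f0P K)
    ((p * u.1)%g, (p * u.2)%g) = bm_act p (f0 K u).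
  by apply: bset_hom_eq => m /=; rewrite !mulgA.
pose f K := @BMHom _ _ _ _ A (prod_bmset R R) (coinduced X)
  (@BSetHom _ _ _ MM (coinduced X) _ (@f0P K)) (f0E K).
have e : exp_beq \top (f F) (f G).
  apply: refl => y; suff -> : f F ((1%g : M), y) = f G ((1%g : M), y).
    exact: beq_refl.
  by apply: bset_hom_eq => m /=; rewrite mulg1.
move=> [m n]; have := e m n; rewrite act1 /beq bop_top.
move=> /(congr1 (fun k : coinduced X => (k : bset_hom _ _) (1%g : M))) /=.
by rewrite !mul1g.
Qed.

Lemma untwist_le (K L : bset_hom MM (Idl_bset J)) : unit_restriction_iso ->
  (forall m n, fle (K (m, (m * n)%g) : Idl J) (L (m, (m * n)%g))) ->
  forall u, fle (K u : Idl J) (L u).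
Proof.
move=> cc KL u; apply/fleP.
have KLP b (v w : MM) : beq (bset_str MM) b v w -> beq (bset_str (Idl_bset J)) b
    (fmeet (K v : Idl J) (L v)) (fmeet (K w : Idl J) (L w)).
  move=> h; apply/beq_Idl.
  by apply: ideal_beq_meet; apply/beq_Idl; exact: bset_funP.
apply: (untwist_inj (F := @BSetHom _ _ _ MM (Idl_bset J) _ KLP) (G := K)) => //.
by move=> m n; apply/fleP; exact: KL.
Qed.

(** For an invertible [p], the ideal [F n (p, q)] is the truth value of
    [p^-1 q = n], and [F n (m, 1)] that of [m^-1 = n]. These values cover
    everything because [p^-1 q = y] for [q = p y]. Moreover [F n (m, 1)] is below
    the truth value of [m n = 1] since [p^-1 q = n] implies [p n = q], and below
    that of [n m = 1] over the target of [m] since [p^-1 q = n] implies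
    [p^-1 (q m) = n m]. Implications of this kind need to be checked for
    [q = p y] only. *)
Lemma local_inverses_of_unit_restriction_iso :
  unit_restriction_iso -> locally_invertible A.
Proof.
move=> cc; apply/locally_invertibleP => m.
pose e (y n : M) : Idl J := @eq_ideal _ _ J R y n.
have eP b y y' n n' : beqM b y y' -> beqM b n n' ->
    ideal_beq b (e y n) (e y' n') by exact: (@eq_ideal_cong _ _ J R).
have /choice [F FE] n : exists F : bset_hom MM (Idl_bset J),
    forall p y, F (p, (p * y)%g) = act_ideal A p (e y n).
  apply: untwist_exists => // [b p p' y h|p b y y' h].
    by apply/beq_Idl; exact: act_ideal_cong.
  by apply/beq_Idl; apply: act_ideal_beq; apply: eP => //; exact: beq_refl.
apply: (@invertible_of_cover _ _ _ _ A m (fun n => F n (m, 1%g))).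
  move=> n b Fb; split.
    have GP a (u v : MM) : beq (bset_str MM) a u v ->
        beq (bset_str (Idl_bset J)) a (e (u.1 * n)%g u.2) (e (v.1 * n)%g v.2).
      move=> /beq_prod [h1 h2]; apply/beq_Idl.
      by apply: eP => //; exact: mp_mul_congl.
    apply: (untwist_le (K := F n) (L := BSetHom GP) cc _ Fb) => p y c.
    rewrite FE => hc.
    apply: (hc (e (p * n)%g (p * y)%g : closed_ideal J)) => _ [a yn <-].
    exact: mp_mul_congr (beq_sym yn).
  have GP a (u v : MM) : beq (bset_str MM) a u v -> beq (bset_str (Idl_bset J)) a
      (F (n * m)%g (u.1, (u.2 * m)%g)) (F (n * m)%g (v.1, (v.2 * m)%g)).
    move=> /beq_prod [h1 h2]; apply: bset_funP; apply/beq_prod.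
    by split=> //; exact: mp_mul_congl.
  have GE : (BSetHom GP : bset_hom MM (Idl_bset J)) (m, 1%g) =
    act_ideal A m (e 1%g (n * m)%g) by rewrite /= mul1g -FE mulg1.
  have := untwist_le (K := F n) (L := BSetHom GP) cc _ Fb; rewrite GE => h.
  have : (act_ideal A m (e 1%g (n * m)%g) : closed_ideal J) b.
    apply: h => p y /=; rewrite -mulgA !FE; apply: act_ideal_le => c.
    exact: mp_mul_congl.
  by apply: act_ideal_le => c; exact: beq_sym.
have SP a (u v : MM) : beq (bset_str MM) a u v -> beq (bset_str (Idl_bset J)) a
    (fsup [set F n u | n in setT] : Idl J) (fsup [set F n v | n in setT] : Idl J).
  move=> h; apply/beq_Idl; apply: ideal_beq_sup => n _.
  by apply/beq_Idl; exact: bset_funP.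
pose T := @BSetHom _ _ _ MM (Idl_bset J) (fun=> ftop (Idl J))
  (fun b _ _ _ => beq_refl _ b _).
apply: (untwist_le (K := T) (L := BSetHom SP) cc _ (u := (m, 1%g)) (b := \top)) => //.
move=> p y; apply: (@fle_trans _ _ (F y (p, (p * y)%g) : Idl J)).
  have -> : T (p, (p * y)%g) = act_ideal A p (ftop (Idl J)).
    by rewrite act_ideal_top.
  by rewrite FE; apply: act_ideal_le => c _; exact: beq_refl.
by apply: fle_sup; exists y.
Qed.

End Exponentials.

(** * The étale condition *)

Section Etale.
Context {d : Order.disp_t} {B : ctbDistrLatticeType d} {J : zdtopology B}.
Context {M : monoidType} (A : matched_pair J M).
Implicit Types (m n p : M) (b c e : B).

Local Notation act := (mp_act A).
Local Notation beqM := (beq (mp_bset A)).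
Local Notation res := (res A).

Lemma resP (s : rmonoid A) : exists m b, s = res m b.
Proof.
exists (repr s).2, (repr s).1.
by rewrite /Defs.res -surjective_pairing reprK.
Qed.

Lemma rm_le_res m b n c : rm_le (res m b) (res n c) <-> b <= c /\ beqM b m n.
Proof.
rewrite /rm_le rm_plusE rm_mulE mul1g mp_act1; split.
  move=> /res_eq [e h]; split; first by rewrite -e leIr.
  by rewrite e in h; exact: beq_sym.
move=> [/meet_idPl e h]; apply/res_eq; rewrite e; split=> //.
exact: beq_sym.
Qed.

Lemma partial_iso_res m b : rm_partial_iso (res m b) <-> invertible_part A m b.
Proof.
split=> [[t]|[n [c [hb mn nm]]]].
  have [n [c ->]] := resP t.
  rewrite !rm_mulE !rm_plusE => -[/res_eq [e1 h1] /res_eq [e2 h2]].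
  exists n, c; split; first by rewrite -e1 leIr.
    by rewrite e1 in h1.
  by rewrite e2 in h2.
(* Cut the inverse down so that its domain is exactly the image of [b]. *)
exists (res n (c `&` act n b)); rewrite !rm_mulE !rm_plusE.
have ub : b <= act m (act n b) by rewrite -mp_actM; exact: le_act_unit mn _.
split; apply/res_eq; split.
- by apply/meet_idPl; rewrite actI lexI hb.
- by apply: beq_le mn; exact: leIl.
- by rewrite -meetA meetxx.
- by apply: beq_le nm; rewrite -meetA leIl.
Qed.

Lemma etaleP : is_etale A <-> locally_invertible A.
Proof.
split=> [et m|inv s]; last first.
  have [m [a ->]] := resP s; have [Q JQ hQ] := inv m.
  have [_ [_ lub] dis] := zdt_partition JQ.
  exists [set res m (a `&` q) | q in Q]; split.
  - split.
      move=> _ _ [q Qq <-] [r Qr <-] ne; rewrite !rm_plusE rm_mulE mp_act1.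
      apply/res_eq; rewrite meetACA meetxx (dis q r) ?meetx0 ?mulg1.
      + by split=> //; exact: beq_bot.
      + by [].
      + by [].
      + by move=> e; apply: ne; rewrite e.
    exists (minus0 [set x | exists q r,
      [/\ Q q, minus0 [set a; ~` a] r & x = q `&` r]]).
      by apply: zdt_refine => // q _; exact: partition_compl.
    move=> b [[_ [q Qq <-]]]; rewrite rm_plusE => /res_eq [<- _] ne.
    split=> //; exists q, a; split=> //; last by rewrite meetC.
    by split; [left|move=> a0; apply: ne; rewrite a0 meet0x].
  - move=> _ [q Qq <-]; apply/partial_iso_res.
    exact: invertible_part_le (leIr _ _) (hQ q Qq).
  - split=> [_ [q Qq <-]|u hu].
      by apply/rm_le_res; split; [exact: leIl|exact: beq_refl].
    have [n [c un]] := resP u; rewrite un in hu *.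
    have {}hu q : Q q -> a `&` q <= c /\ beqM (a `&` q) m n.
      by move=> Qq; apply/rm_le_res; apply: hu; exists q.
    apply/rm_le_res; split; last by apply: (beq_sep_le JQ) => q /hu [].
    have : \top <= c `|` ~` a.
      apply: lub => q /hu [h _].
      rewrite -[q]meetx1 -(joinxC a) meetUr leU2 ?leIr //.
      by rewrite meetC.
    move=> h; rewrite -[a]meet1x; apply: le_trans (leI2 h (lexx _)) _.
    by rewrite meetUl meetCx joinx0 leIl.
have [T [[_ [Q JQ TQ]] iso [ub lub]]] := et (res m \top).
exists Q => // q Qq.
have [Q0 _ dis] := zdt_partition JQ.
have [[b [Tb bq]]|nT] := pselect (exists b, T (res m b) /\ b = q).
  by rewrite -bq; apply/partial_iso_res; exact: iso.
(* A cell that is not the domain of a member of [T] could be removed from the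
   domain of the join. *)
suff : rm_le (res m \top) (res m (~` q)).
  move=> /rm_le_res [+ _]; rewrite lexC compl1 lex0 => /eqP q0.
  by case: Q0; rewrite -q0.
apply: lub => t Tt; have [n [e te]] := resP t; rewrite te in Tt *.
have /rm_le_res [_ nm] := ub _ Tt.
apply/rm_le_res; split=> //; rewrite -disj_leC.
have [->|/eqP e0] := eqVneq e \bot; first by rewrite meet0x.
have Tm : T (res m e).
  by rewrite (_ : res m e = res n e) //; apply/res_eq; split=> //; exact: beq_sym.
apply/eqP; apply: dis => //.
  by apply: TQ; split=> //; exists (res m e) => //; rewrite rm_plusE.
by move=> eq; apply: nT; exists e.
Qed.

End Etale.

(** * The localic groupoid *)

Section LocalicGroupoid.
Context {d : Order.disp_t} {B : ctbDistrLatticeType d} {J : zdtopology B}.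
Context {M : monoidType} (A : matched_pair J M).
Implicit Types (m n p : M) (b c e : B).

Local Notation act := (mp_act A).
Local Notation beqM := (beq (mp_bset A)).
Local Notation arrows := (arrow_frame A).
Local Notation pairs := (pair_frame A).
Local Notation Idls := (Idl_bset J).

Section GroupoidStructure.
Hypothesis inv : locally_invertible A.

Lemma pair_inverse_twisted (g : pairs) m :
  twisted A (X := Idls) m (fun n => (g : subpower _) (m, n)).
Proof.
by move=> c n n' h; apply/beq_Idl; exact: (subpowerP (g : subpower _)).2.
Qed.

Lemma inverse_pair_twisted (g : pairs) m :
  twisted A (X := Idls) m (fun n => act_ideal A m ((g : subpower _) (n, m))).
Proof.
move=> c n n' h; apply/beq_Idl; apply: act_ideal_beq.
exact: (subpowerP (g : subpower _)).1.
Qed.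

Definition pair_inverse (g : pairs) m : Idl J :=
  at_inverse inv (pair_inverse_twisted g m).

Definition inverse_pair (g : pairs) m : Idl J :=
  at_inverse inv (inverse_pair_twisted g m).

Lemma pair_inverse_cond g : arrow_cond A (pair_inverse g).
Proof.
move=> b m m' h; apply/beq_Idl; apply: at_inverse_cong => // e n c _.
apply/beq_Idl; apply: ideal_beq_le (leIl _ _) _.
exact: (subpowerP (g : subpower _)).1.
Qed.

Lemma inverse_pair_cond g : arrow_cond A (inverse_pair g).
Proof.
move=> b m m' h; apply/beq_Idl; apply: at_inverse_cong => // e n c [_ mn _].
apply/beq_Idl; apply: (@ideal_beq_trans _ _ _ _ _ (act_ideal A m' ((g : subpower _) (n, m)))).
  by apply: ideal_beq_le (leIl _ _) _; exact: act_ideal_cong.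
have := act_ideal_beq A m' ((subpowerP (g : subpower _)).2 _ n _ _ h).
apply: ideal_beq_le; apply: (@act_congr _ _ _ _ A _ m).
  exact: beq_le (leIl _ _) h.
rewrite -mp_actM; apply: le_trans (le_act_unit mn (leIr e b)) _.
by apply: act_le; exact: leIl.
Qed.

Lemma pair_inverse_eq (g : pairs) m (I : Idl J) :
  (forall b n c, local_inverse A m b n c ->
     ideal_beq b I ((g : subpower _) (m, n))) ->
  pair_inverse g m = I.
Proof.
move=> h; apply: (at_inverse_eq inv (pair_inverse_twisted g m)) => b n c hb.
by apply/beq_Idl; exact: h hb.
Qed.

Lemma pair_inverseE (g : pairs) m b n c : local_inverse A m b n c ->
  ideal_beq b (pair_inverse g m) ((g : subpower _) (m, n)).
Proof.
by move=> hb; apply/beq_Idl; exact: (at_inverseE inv (pair_inverse_twisted g m) hb).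
Qed.

Lemma inverse_pair_eq (g : pairs) m (I : Idl J) :
  (forall b n c, local_inverse A m b n c ->
     ideal_beq b I (act_ideal A m ((g : subpower _) (n, m)))) ->
  inverse_pair g m = I.
Proof.
move=> h; apply: (at_inverse_eq inv (inverse_pair_twisted g m)) => b n c hb.
by apply/beq_Idl; exact: h hb.
Qed.

Lemma inverse_pairE (g : pairs) m b n c : local_inverse A m b n c ->
  ideal_beq b (inverse_pair g m) (act_ideal A m ((g : subpower _) (n, m))).
Proof.
by move=> hb; apply/beq_Idl; exact: (at_inverseE inv (inverse_pair_twisted g m) hb).
Qed.

(** The map [(id, inv)] from arrows to composable pairs. *)
Definition lc_pair_inverse : locale_map arrows pairs.
Proof.
refine (@LocaleMap arrows pairs
  (fun g => SubPower (pair_inverse_cond g)) _ _ _).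
- by apply: subpower_eq => m; exact: pair_inverse_eq.
- move=> f g; apply: subpower_eq => m; apply: pair_inverse_eq => b n c hb.
  by apply: ideal_beq_meet; exact: pair_inverseE hb.
- move=> U; apply: subpower_eq => m; apply: pair_inverse_eq => b n c hb /=.
  rewrite image_comp; apply: ideal_beq_sup => g _ /=.
  exact: pair_inverseE hb.
Defined.

(** The map [(inv, id)] from arrows to composable pairs. *)
Definition lc_inverse_pair : locale_map arrows pairs.
Proof.
refine (@LocaleMap arrows pairs
  (fun g => SubPower (inverse_pair_cond g)) _ _ _).
- apply: subpower_eq => m; apply: inverse_pair_eq => b n c hb.
  by rewrite act_ideal_top.
- move=> f g; apply: subpower_eq => m; apply: inverse_pair_eq => b n c hb.
  rewrite [X in ideal_beq _ _ X]act_ideal_meet.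
  by apply: ideal_beq_meet; exact: inverse_pairE hb.
- move=> U; apply: subpower_eq => m; apply: inverse_pair_eq => b n c hb /=.
  rewrite [X in ideal_beq _ _ X]act_ideal_sup !image_comp.
  apply: ideal_beq_sup => g _ /=.
  exact: inverse_pairE hb.
Defined.

Definition lc_inverse : locale_map arrows arrows :=
  locale_cmp (lc_snd A) lc_pair_inverse.

Lemma localic_groupoid_of_local_inverses :
  is_internal_groupoid (classifying_localic_category A).
Proof.
have undo m b n c (I : Idl J) : local_inverse A m b n c ->
    ideal_beq b I (act_ideal A m (act_ideal A n I)).
  move=> [_ mn _]; rewrite -act_idealM -{1}(act_ideal1 A I); apply/esym.
  exact: act_ideal_cong.
exists lc_inverse; split.
- apply: locale_map_eq => I; apply: subpower_eq => m.
  by apply: pair_inverse_eq => b n c hb; exact: erefl.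
- apply: locale_map_eq => I; apply: subpower_eq => m.
  by apply: pair_inverse_eq => b n c hb; exact: undo hb.
- exists lc_pair_inverse; split=> //.
    apply: locale_map_eq => f; apply: subpower_eq => m.
    by apply: pair_inverse_eq => b n c hb.
  apply: locale_map_eq => f; apply: subpower_eq => m.
  apply: pair_inverse_eq => b n c [_ mn _]; apply/esym.
  exact: (subpowerP (f : subpower _)).
- exists lc_inverse_pair; split.
  + apply: locale_map_eq => f; apply: subpower_eq => m.
    apply: inverse_pair_eq => b n c hb.
    exact: (pair_inverseE (inv_image (lc_snd A) f) hb).
  + apply: locale_map_eq => f; apply: subpower_eq => m.
    by apply: inverse_pair_eq => b n c hb; exact: undo hb.
  + apply: locale_map_eq => f; apply: subpower_eq => m.
    apply: inverse_pair_eq => b n c [hb _ nm]; apply/esym.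
    apply: ideal_beq_le hb _; apply: act_ideal_beq.
    exact: (subpowerP (f : subpower _)).
Qed.

End GroupoidStructure.

(** The open of those arrows that are equal to [n]. *)
Definition arrow_open n : arrows := @SubPower _ _ (arrow_cond A)
  (fun m => @eq_ideal _ _ J (regular_bmset A) m n)
  (fun b m m' h => @eq_ideal_cong _ _ J (regular_bmset A) b m m' n n h
     (beq_refl _ _ _)).

Lemma locale_map_le (X Y : frame) (f : locale_map X Y) x y :
  fle x y -> fle (f x) (f y).
Proof.
by move=> /fleP h; apply/fleP; rewrite -inv_image_meet h.
Qed.

(** Over the open where the inverse of [m] equals [n], the composites
    [m n] and [n m] are identities, because [(id, inv)] and [(inv, id)] pull
    back the inclusion of the product of the opens of [m] and [n] in the open of
    [m n]. *)
Lemma local_inverses_of_localic_groupoid :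
  is_internal_groupoid (classifying_localic_category A) -> locally_invertible A.
Proof.
move=> [i [_ _ [h [h1 h2 h3]] [k [k1 k2 k3]]]].
apply/locally_invertibleP => m.
have comp_le m1 m2 : fle (fmeet (lc_fst A (arrow_open m1)) (lc_snd A (arrow_open m2)))
    (lc_comp A (arrow_open (m1 * m2)%g)).
  move=> [p q] b [/= pm hq].
  rewrite -[b]meetxx.
  apply: (hq (ideal_local (@eq_ideal _ _ J (regular_bmset A) (p * q)%g (m1 * m2)%g) b)).
  move=> _ [c qm <-] /=.
  apply: beq_trans (beq_le (leIl _ _) (mp_mul_congr p qm)) _.
  exact: beq_le (leIr _ _) (mp_mul_congl _ pm).
have app (X Y : frame) (f g : locale_map X Y) x : f = g -> f x = g x by move=> ->.
have hle m1 m2 : fle (fmeet (arrow_open m1) ((i : locale_map _ _) (arrow_open m2)))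
    (lc_src A (lc_id A (arrow_open (m1 * m2)%g))).
  have := locale_map_le (h : locale_map arrows pairs) (comp_le m1 m2).
  rewrite inv_image_meet.
  have /= -> := app _ _ _ _ (arrow_open m1) h1.
  have /= -> := app _ _ _ _ (arrow_open m2) h2.
  by have /= -> := app _ _ _ _ (arrow_open (m1 * m2)%g) h3.
have kle m1 m2 : fle (fmeet ((i : locale_map _ _) (arrow_open m1)) (arrow_open m2))
    (lc_tgt A (lc_id A (arrow_open (m1 * m2)%g))).
  have := locale_map_le (k : locale_map arrows pairs) (comp_le m1 m2).
  rewrite inv_image_meet.
  have /= -> := app _ _ _ _ (arrow_open m1) k1.
  have /= -> := app _ _ _ _ (arrow_open m2) k2.
  by have /= -> := app _ _ _ _ (arrow_open (m1 * m2)%g) k3.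
apply: (@invertible_of_cover _ _ _ _ A m
  (fun n => ((i : locale_map arrows arrows) (arrow_open n) : subpower _) m)).
  move=> n b ib; split.
    by apply: beq_sym; apply: (hle m n m b); split; [exact: beq_refl|exact: ib].
  have := kle n m m b (conj ib (beq_refl _ _ _)).
  by apply: act_ideal_le => c; exact: beq_sym.
have cover : fsup (range arrow_open) = ftop arrows.
  apply: subpower_eq => p; apply: closed_ideal_eq => b; split=> // _ /=.
  apply: ideal_gen_sub; exists ((arrow_open p : subpower _) p).
    by exists (arrow_open p) => //; exists p.
  exact: beq_refl.
have := congr1 (fun f : arrows => (f : subpower _) m)
  (inv_image_sup (i : locale_map arrows arrows) (range arrow_open)).
rewrite cover inv_image_top /= !image_comp => e.
by have : ideal_full J \top by []; rewrite e.
Qed.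

End LocalicGroupoid.

(** * The topological groupoid *)

Section Ultrafilters.
Context {d : Order.disp_t} {B : ctbDistrLatticeType d} (J : zdtopology B).
Implicit Types (U : ultrafilter B) (b c : B).

Lemma uf_joinE U b c : U (b `|` c) -> U b \/ U c.
Proof.
move=> Ubc; have [Ub|Ub'] := uf_compl U b; [by left|right].
apply: uf_le (uf_meet Ubc Ub'); rewrite meetUl meetxC join0x; exact: leIl.
Qed.

Lemma uf_partition U Q : J Q -> finite_set Q -> exists2 q, Q q & U q.
Proof.
move=> JQ /finite_seqP [s Qs].
have [_ [_ lub] _] := zdt_partition JQ; rewrite {}Qs {JQ Q} in lub *.
have : U (\join_(q <- s) q).
  apply: uf_le (uf_top U); apply: lub => q qs.
  exact: joins_sup_seq.
elim: s {lub} => [|q s IH]; first by rewrite big_nil => /uf_bot.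
rewrite big_cons => /uf_joinE [Uq|/IH [r rs Ur]].
  by exists q => //=; exact: mem_head.
by exists r => //=; rewrite inE (rs : r \in s) orbT.
Qed.

(** The prime ideal theorem. Zorn's lemma is applied to sets of generators
    rather than to filters, so that the union of the empty chain qualifies. *)
Lemma ultrafilter_avoiding (I : closed_ideal J) :
  ~ I \top -> exists U : ultrafilter B, forall b, I b -> ~ U b.
Proof.
move=> Itop; pose meets (s : seq B) := \meet_(x <- s) x.
pose below (s : seq B) (X : set B) := forall x, x \in s -> X x.
(* The sets whose generated filter is disjoint from [I]. *)
pose P := [set X : set B | forall s, below s X -> ~ I (meets s)].
have [F FP tot|X [PX maxX]] := @Zorn_bigcup B P.
  have chain (s : seq B) : below s (\bigcup_(X in F) X) ->
      s = [::] \/ exists2 X, F X & below s X.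
    elim: s => [|x s IH] hs; [by left|right].
    have [X FX Xx] : (\bigcup_(X in F) X) x by apply: hs; exact: mem_head.
    have [|s0|[Y FY sY]] := IH.
    - by move=> y ys; apply: hs; rewrite inE ys orbT.
    - by exists X => // y; rewrite s0 inE => /eqP ->.
    have [XY|YX] := tot X Y FX FY.
      exists Y => // y; rewrite inE => /orP [/eqP ->|/sY //].
      exact: XY.
    exists X => // y; rewrite inE => /orP [/eqP -> //|/sY Yy].
    exact: YX.
  move=> s /chain [->|[X FX sX]]; first by rewrite /meets big_nil.
  exact: FP FX s sX.
have inX b : (forall s, below s X -> ~ I (b `&` meets s)) -> X b.
  move=> hb; apply: contrapT => nXb; apply: (maxX (b |` X)).
    split; first by move=> x Xx; right.
    by move=> /(_ b (or_introl erefl)).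
  move=> s hs Is.
  have [t tX ts] : exists2 t, below t X & b `&` meets t <= meets s.
    elim: s hs {Is} => [|x s IH] hs.
      by exists [::] => //; rewrite /meets !big_nil meetx1 lex1.
    have [|t tX ts] := IH; first by move=> y ys; apply: hs; rewrite inE ys orbT.
    have [->|Xx] := hs x (mem_head _ _).
      by exists t => //; rewrite /meets big_cons lexI leIl.
    exists (x :: t); first by move=> y; rewrite inE => /orP [/eqP ->|/tX].
    by rewrite /meets !big_cons meetCA leI2.
  exact: hb tX (ideal_le ts Is).
have Xin b s : X b -> below s X -> ~ I (b `&` meets s).
  move=> Xb sX; have := PX (b :: s); rewrite /meets big_cons; apply.
  by move=> y; rewrite inE => /orP [/eqP ->|/sX].
unshelve eexists (@Ultrafilter _ B X _ _ _ _ _).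
- by apply: inX => s sX; rewrite meet1x; exact: PX.
- move=> b c Xb Xc; apply: inX => s sX; rewrite -meetA.
  have := Xin b (c :: s) Xb; rewrite /meets big_cons; apply.
  by move=> y; rewrite inE => /orP [/eqP ->|/sX].
- move=> b c bc Xb; apply: inX => s sX Ics; apply: (Xin b s Xb sX).
  by apply: ideal_le Ics; rewrite leI2.
- by move=> X0; apply: (Xin _ [::] X0) => //; rewrite meet0x; exact: ideal_bot.
- move=> b; apply: contrapT => /not_orP [nb nb'].
  have /existsNP [s /not_implyP [sX /contrapT Is]] := contra_not (inX b) nb.
  have /existsNP [t /not_implyP [tX /contrapT It]] := contra_not (inX (~` b)) nb'.
  apply: (PX (s ++ t)).
    by move=> y; rewrite mem_cat => /orP [/sX|/tX].
  apply: ideal_le (ideal_join Is It); rewrite /meets big_cat /=.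
  rewrite -[X in X <= _]meet1x -(joinxC b) meetUl leU2 //; apply: leI2 => //.
    exact: leIl.
  exact: leIr.
by move=> b Ib /= Xb; apply: (Xin b [::] Xb) => //; rewrite /meets big_nil meetx1.
Qed.

End Ultrafilters.

Section TopologicalGroupoid.
Context {d : Order.disp_t} {B : ctbDistrLatticeType d} {J : zdtopology B}.
Context {M : monoidType} (A : matched_pair J M).
Implicit Types (U V : ultrafilter B) (m n p : M) (b c e : B).

Local Notation act := (mp_act A).
Local Notation beqM := (beq (mp_bset A)).
Local Notation comp_pair := (@composable _ _ _ _ A).

Lemma germP (x : germ A) : exists U m, x = mk_germ A U m.
Proof. by exists (repr x).1, (repr x).2; rewrite mk_germ_repr. Qed.

Lemma germ_inverse_uniq U m b n c b' n' c' :
  local_inverse A m b n c -> local_inverse A m b' n' c' -> U b -> U b' ->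
  mk_germ A (uf_push A m U) n = mk_germ A (uf_push A m U) n'.
Proof.
move=> h h' Ub Ub'; have [le eq] := local_inverse_uniq h h'.
apply/mk_germ_eq; split=> //; exists (c `&` act n b') => //=.
by apply: uf_le le _; exact: uf_meet.
Qed.

Section GroupoidStructure.
Hypothesis inv : forall U m, exists b n c, U b /\ local_inverse A m b n c.

Lemma germ_inverse_subproof (x : germ A) : exists y, exists b n c,
  [/\ (repr x).1 b, local_inverse A (repr x).2 b n c &
      y = mk_germ A (germ_tgt x) n].
Proof.
have [b [n [c [Ub h]]]] := inv (repr x).1 (repr x).2.
by exists (mk_germ A (germ_tgt x) n), b, n, c.
Qed.

Definition germ_inverse (x : germ A) : germ A :=
  projT1 (cid (germ_inverse_subproof x)).

Lemma germ_inverseE U m b n c : U b -> local_inverse A m b n c ->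
  germ_inverse (mk_germ A U m) = mk_germ A (uf_push A m U) n.
Proof.
move=> Ub h; rewrite /germ_inverse; case: cid => _ /= [b' [n' [c' [Ub' h' ->]]]].
have [eU [e Ue em]] := repr_germ A U m; rewrite eU in Ub'.
rewrite /germ_tgt eU; have := local_inverse_cong (beq_sym em) h => h1.
rewrite (germ_inverse_uniq h' h1 Ub' (uf_meet Ue Ub)).
by rewrite (@uf_push_cong _ _ _ _ A U _ m) //; exists e.
Qed.

Lemma germ_inverse_cont : continuous germ_inverse.
Proof.
apply: continuous_germ => -[a r].
rewrite (_ : _ @^-1` _ = \bigcup_(i in [set i : B * M | exists n c a',
    [/\ local_inverse A i.2 i.1 n c, i.1 <= act i.2 (a `&` a') & beqM a' n r]])
    (germ_basic i : set (germ A))).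
  by apply: bigcup_open => i _; exact: open_germ_basic.
apply/seteqP; split=> [x|_ [[e m] [n [c [a' [h le nr]]]] /= [U Ue <-]]].
  have [U [m ->]] := germP x; have [b [n [c [Ub h]]]] := inv U m.
  rewrite /preimage /= (germ_inverseE Ub h) => -[V Va /mk_germ_eq /= [eV [a' Va' rn]]].
  rewrite {}eV in Va Va'; exists (b `&` act m (a `&` a'), m) => /=.
    exists n, c, a'; split; [|exact: leIr|exact: beq_sym].
    by apply: local_inverse_le h; exact: leIl.
  by exists U => //=; apply: uf_meet => //; rewrite actI; exact: uf_meet.
rewrite /preimage /= (germ_inverseE Ue h).
have /= : uf_push A m U (a `&` a') by exact: uf_le le Ue.
move=> Uaa'; exists (uf_push A m U) => /=.
  by apply: uf_le Uaa'; apply: act_le; exact: leIl.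
apply/mk_germ_eq; split=> //; exists a'; last exact: beq_sym.
by apply: uf_le Uaa'; apply: act_le; exact: leIr.
Qed.

Definition composable_pair (f g : germ A -> germ A)
    (fg : forall x, comp_pair (f x, g x)) (x : germ A) : comp_pair :=
  exist _ (f x, g x) (mem_set (fg x)).

Lemma composable_pair_cont (f g : germ A -> germ A)
    (fg : forall x, comp_pair (f x, g x)) :
  continuous f -> continuous g -> continuous (composable_pair fg).
Proof.
move=> cf cg; have cfg : continuous (fun x => (f x, g x)).
  by move=> x; exact: (cvg_pair (cf x) (cg x)).
apply/continuousP => _ [D oD <-].
by move/continuousP : cfg => /(_ D oD).
Qed.

Lemma topological_groupoid_of_inverses :
  is_internal_groupoid (classifying_topological_category A).
Proof.
have undo U m b n c : U b -> local_inverse A m b n c ->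
    uf_push A n (uf_push A m U) = U.
  move=> Ub [_ mn _]; apply: ultrafilter_eq => a /=; rewrite -mp_actM.
  have e : uf_push A (m * n)%g U = uf_push A 1%g U by apply: uf_push_cong; exists b.
  by have /= -> := congr1 (fun V : ultrafilter B => V a) e; rewrite mp_act1.
have fwd x : comp_pair (x, germ_inverse x).
  have [U [m ->]] := germP x; have [b [n [c [Ub h]]]] := inv U m.
  by rewrite /composable /= (germ_inverseE Ub h) germ_tgtE germ_srcE.
have bwd x : comp_pair (germ_inverse x, x).
  have [U [m ->]] := germP x; have [b [n [c [Ub h]]]] := inv U m.
  rewrite /composable /= (germ_inverseE Ub h) germ_tgtE germ_srcE.
  exact: undo Ub h.
have id_cont : continuous (fun x : germ A => x) by move=> x; exact: cvg_id.
exists (ContMap germ_inverse_cont); split.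
- by apply: cont_map_eq => x /=; have := fwd x; rewrite /composable /= => ->.
- by apply: cont_map_eq => x /=; have := bwd x.
- exists (ContMap (composable_pair_cont (fg := fwd) id_cont germ_inverse_cont)).
  split; apply: cont_map_eq => // x.
  have [U [m ->]] := germP x; have [b [n [c [Ub h]]]] := inv U m.
  rewrite /= (@germ_compE _ _ _ _ _ U m n); last by rewrite /= (germ_inverseE Ub h).
  rewrite germ_srcE; apply/mk_germ_eq; split=> //; exists b => //.
  by case: h.
- exists (ContMap (composable_pair_cont (fg := bwd) germ_inverse_cont id_cont)).
  split; apply: cont_map_eq => // x.
  have [U [m ->]] := germP x; have [b [n [c [Ub h]]]] := inv U m.
  rewrite /= (@germ_compE _ _ _ _ _ (uf_push A m U) n m); last first.
    by rewrite /= (germ_inverseE Ub h) (undo U m b n c).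
  rewrite germ_tgtE; apply/mk_germ_eq; split=> //; exists c; last by case: h.
  by case: h => hb _ _; exact: uf_le hb Ub.
Qed.

End GroupoidStructure.

Lemma inverses_of_topological_groupoid :
  is_internal_groupoid (classifying_topological_category A) ->
  forall U m, exists b n c, U b /\ local_inverse A m b n c.
Proof.
move=> [i [_ _ [h [h1 h2 h3]] [k [k1 k2 k3]]]] U m.
have app (X Y : topologicalType) (f g : cont_map X Y) x : f = g -> f x = g x.
  by move=> ->.
have [V [n iE]] := germP ((i : cont_map (germ A) (germ A)) (mk_germ A U m)).
set x := mk_germ A U m in iE.
have /= hf := app _ _ _ _ x h1; have /= hs := app _ _ _ _ x h2.
have /= hc := app _ _ _ _ x h3; have /= kf := app _ _ _ _ x k1.
have /= ks := app _ _ _ _ x k2; have /= kc := app _ _ _ _ x k3.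
set hx := (h : cont_map _ _) x in hf hs hc.
set kx := (k : cont_map _ _) x in kf ks kc.
have hxE : val hx = (x, mk_germ A V n).
  by rewrite [LHS]surjective_pairing -iE; congr pair; [exact: hf|exact: hs].
have kxE : val kx = (mk_germ A V n, x).
  by rewrite [LHS]surjective_pairing -iE; congr pair; [exact: kf|exact: ks].
have VE : uf_push A m U = V.
  by have := set_mem (valP hx); rewrite /composable /= hxE /= germ_tgtE germ_srcE.
have UE : uf_push A n V = U.
  by have := set_mem (valP kx); rewrite /composable /= kxE /= germ_tgtE germ_srcE.
have := @germ_compE _ _ _ _ A U m n hx.
rewrite hc VE => /(_ hxE) /esym /mk_germ_eq [_ [b Ub mn]].
have := @germ_compE _ _ _ _ A V n m kx.
rewrite kc UE => /(_ kxE) /esym /mk_germ_eq [_ [c Vc nm]].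
exists (b `&` act m c), n, c; split.
  by apply: uf_meet => //; move: Vc; rewrite -VE.
split=> //; first exact: leIr.
exact: beq_le (leIl _ _) mn.
Qed.

(** Inverses at all points give local inverses by compactness of the space of
    ultrafilters. For the other direction the covering partition has to be
    finite, so that every ultrafilter contains one of its members. *)
Lemma topological_groupoidP : finite_topology J ->
  is_internal_groupoid (classifying_topological_category A) <->
  locally_invertible A.
Proof.
move=> finJ; split=> [/inverses_of_topological_groupoid inv|inv].
  apply/locally_invertibleP => m; apply: contrapT => /ultrafilter_avoiding [U hU].
  have [b [n [c [Ub h]]]] := inv U m.
  by apply: (hU b) => //; apply: ideal_gen_sub; exists n, c.
apply: topological_groupoid_of_inverses => U m; have [Q JQ hQ] := inv m.
have [q /hQ [n [c h]] Uq] := uf_partition U JQ ((finJ Q).1 JQ).2.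
by exists q, n, c.
Qed.

End TopologicalGroupoid.

(** * Equivalence of the conditions *)

Theorem theorem5p3 (d : Order.disp_t) (B : ctbDistrLatticeType d)
    (J : zdtopology B) (M : monoidType) (A : matched_pair J M) :
  [<-> is_cartesian_closed_functor (BMSet_cartesian_closed A)
         (BSet_cartesian_closed J) (forgetful A);
       forall m : M, exists (I : Type) (b : I -> B) (n : I -> M) (c : I -> B),
         J (range b) /\
         forall i, [/\ b i <= mp_act A m (c i),
                       beq (mp_bset A) (b i) (m * n i)%g 1%g &
                       beq (mp_bset A) (c i) (n i * m)%g 1%g];
       is_etale A;
       is_internal_groupoid (classifying_localic_category A)]
  /\ (finite_topology J ->
      is_internal_groupoid (classifying_localic_category A) <->
      is_internal_groupoid (classifying_topological_category A)).
Proof.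
split.
  tfae.
  - move=> /cartesian_closed_forgetfulP.
    by move=> /local_inverses_of_unit_restriction_iso/locally_invertible_indexedP.
  - by move=> /locally_invertible_indexedP/etaleP.
  - by move=> /etaleP; exact: localic_groupoid_of_local_inverses.
  - move=> /local_inverses_of_localic_groupoid inv.
    apply/cartesian_closed_forgetfulP.
    exact: unit_restriction_iso_of_local_inverses.
move=> finJ; split.
  by move=> /local_inverses_of_localic_groupoid/(topological_groupoidP A finJ).
move=> /(topological_groupoidP A finJ).
exact: localic_groupoid_of_local_inverses.
Qed.
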